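(* Let $\Bbbk$ be an infinite field with $\operatorname{char}\Bbbk = 0$, let $R = \Bbbk[x_0,\dots,x_n]$, and let $I \subset R$ be a homogeneous ideal. Suppose that for some degree $d$ and integers $c$ and $k$ we have the $d$-binomial expansion $$h_d=\binom{d+c}{d}+\cdots+\binom{d+c-k}{d-k}$$ and that $$\ell_d=(h_d)|^{-1}_{\phantom{-}0}.$$ Then there is a hypersurface $F$ of degree $k+1$ in a $(c+1)$-dimensional linear space $\Lambda\subset\mathbb P(R_1)$ such that $$[I]_d=[I_\Lambda+I_F]_d=\langle L_0,L_1,\dots,L_{n-c-2},F\rangle_d .$$
   Context: $[M]_d$ denotes the degree $d$ component of a graded module $M$. Here $h_d=\dim_\Bbbk[R/I]_d$ and $\ell_d=\dim_\Bbbk[R/(I,L)]_d$, where $L\in[R]_1$ is a general linear form. For positive integers $r,i$, the $i$-binomial expansion of $r$ is the unique expression $r_{(i)}=\binom{r_i}{i}+\binom{r_{i-1}}{i-1}+\cdots+\binom{r_j}{j}$ with $r_i>r_{i-1}>\cdots>r_j\ge j\ge 1$. For integers $a,b$ put $r_{(i)}|^{b}_{a}=\binom{r_i+b}{i+a}+\binom{r_{i-1}+b}{i-1+a}+\cdots+\binom{r_j+b}{j+a}$, where $\binom{m}{q}=0$ whenever $m<q$ or $q<0$; $(h_d)|^{-1}_{\phantom{-}0}$ means $\big((h_d)_{(d)}\big)|^{-1}_{\phantom{-}0}$. $\mathbb P(R_1)$ is the projective space $\mathbb P^n$ with homogeneous coordinate ring $R$. $I_\Lambda$ and $I_F$ are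 the homogeneous ideals of $\Lambda$ and of the hypersurface $F$; $L_0,\dots,L_{n-c-2}$ are linearly independent linear forms generating $I_\Lambda$, and in the last expression $F$ also denotes a form of degree $k+1$ cutting out the hypersurface in $\Lambda$. $\langle\cdots\rangle_d$ is the degree $d$ component of the ideal generated by the listed forms.
   Formalization: The formal theorem assumes 1 ≤ c < n: for c = n there is no (c+1)-dimensional Λ in P^n, and for c = 0 the claim is false, e.g. I = (x²,y²) in 𝕜[x,y], d = 2, k = 0. *)

(* Defs.v *)
From HB Require Import structures.
From mathcomp Require Import all_boot all_order all_algebra.
From mathcomp Require Export mpoly.

Set Implicit Arguments.
Unset Strict Implicit.
Unset Printing Implicit Defensive.

Import Order.TTheory GRing.Theory Num.Theory.

Local Open Scope ring_scope.

(* The sequence s lists the upper entries r_i > r_{i-1} > ... > r_j, so the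
   entry of index t sits above i - t and j = i - (size s).-1; the bound
   size s <= i says that j >= 1. *)
Definition binomial_expansion (r i : nat) (s : seq nat) : Prop :=
  [/\ (0 < size s <= i)%N,
      sorted gtn s,
      (i - (size s).-1 <= last 0 s)%N
    & r = (\sum_(t < size s) 'C(nth 0 s t, i - t))%N].

Definition binz (m q : int) : nat :=
  if 0 <= q <= m then 'C(`|m|%N, `|q|%N) else 0%N.

(* v is the value of r_(i)|^b_a. *)
Definition shifted_expansion (r i : nat) (a b : int) (v : nat) : Prop :=
  exists2 s, binomial_expansion r i s &
    v = (\sum_(t < size s) binz ((nth 0 s t)%:Z + b) ((i - t)%N%:Z + a))%N.

(* Ideals are Prop-valued predicates: the ideals of ring_quotient are decidable
   and proper. *)
Section Ideals.
Variables (K : fieldType) (n : nat).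
Local Notation R := {mpoly K[n.+1]}.

Definition is_ideal (I : R -> Prop) : Prop :=
  [/\ I 0, forall p q, I p -> I q -> I (p + q) & forall p q, I q -> I (p * q)].

Definition homogeneous_ideal (I : R -> Prop) : Prop :=
  is_ideal I /\ forall p d, I p -> I (pihomog mdeg d p).

Definition ideal_gen (S : R -> Prop) (p : R) : Prop :=
  exists (m : nat) (q f : 'I_m -> R),
    (forall i, S (f i)) /\ p = \sum_i q i * f i.

Definition ideal_add (I J : R -> Prop) : R -> Prop :=
  ideal_gen (fun p => I p \/ J p).

Definition eq_in_degree (d : nat) (I J : R -> Prop) : Prop :=
  forall p : dhomog n.+1 K d, I (val p) <-> J (val p).

(* dim [R/I]_d = m: the classes of some m forms of degree d are a basis of
   [R]_d modulo [I]_d. *)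
Definition quotient_dim (I : R -> Prop) (d m : nat) : Prop :=
  exists b : 'I_m -> dhomog n.+1 K d,
  forall p : dhomog n.+1 K d,
  exists! a : {ffun 'I_m -> K}, I (val (p - \sum_i a i *: b i)).

Definition zariski_open (U : dhomog n.+1 K 1 -> Prop) : Prop :=
  exists S : R -> Prop, forall L : dhomog n.+1 K 1,
    U L <-> exists2 g, S g & g.@[fun i => (val L)@_(U_(i))] != 0.

Definition for_general_linear_form (P : dhomog n.+1 K 1 -> Prop) : Prop :=
  exists U, [/\ zariski_open U, exists L, U L & forall L, U L -> P L].

(* A linear subspace of P^n is given by its cone in K^(n+1), of dimension one
   more; over an infinite field its homogeneous ideal is the ideal of all
   polynomials vanishing on that cone. *)
Definition linear_space_ideal (W : {vspace 'rV[K]_n.+1}) (p : R) : Prop :=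
  forall v, v \in W -> p.@[fun i => v 0 i] = 0.

(* The ideal in R of the subscheme of the linear space W cut out by F. *)
Definition hypersurface_ideal (W : {vspace 'rV[K]_n.+1}) (F p : R) : Prop :=
  exists q, linear_space_ideal W (p - q * F).

End Ideals.

(* Main.v *)
(** Write V for [I]_d and V_L, V : L for its restriction to and its residual
    with respect to a linear form L. For general L, L' the inclusion
    (V : L') + (L) <= V_L : L' gives
      codim V_L <= codim (V_L)_{L'} + codim (V : L')_L,
    from which Green's bound codim V_L <= (codim V)_(d)|^{-1}_0 follows by
    induction on d and codim V. When the bound is attained, so is the one for
    V : L, in degree d - 1, and by induction V : L is the degree d - 1 component
    of a hypersurface ideal J_L. In high degree (V : L) : L' = (V : L') : L shows
    that J_L does not depend on L, so that V contains S_1 J_L, and equality holds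
    by counting dimensions. In low degree the same conclusion is drawn from
      S_1 (V : L) <= V_L,
    which holds because the rank of multiplication by L modulo V is maximal, hence
    constant near L. Characteristic 0 enters through the analogous first order
    condition for multiplication by L^a. *)

Require Import Defs.
From HB Require Import structures.
From mathcomp Require Import all_boot all_order all_algebra.
From mathcomp Require Import mpoly.
From mathcomp Require Import zify.
From Stdlib Require Import Classical.

Set Implicit Arguments.
Unset Strict Implicit.
Unset Printing Implicit Defensive.

Import Order.TTheory GRing.Theory Num.Theory.

Local Open Scope ring_scope.

(** Only the component V = [I]_d enters the core argument, and forms are multiplied by linear forms
    only, so an abstract graded family [S] replaces the polynomial ring. The restriction V_L is kept
    in the same space, as V + (L): restricting lowers the codimension in a fixed degree, and no
    second ring is needed for the inner induction. The obstacle is what a double colon forgets,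
    since it lives two degrees below V. If V has degree 2 it lands in degree 0, where nothing is
    left to compare. If V : L is (U, F_L) in the very degree of F_L, it recovers the linear forms U
    but not F_L. In that case two forms F_L, F_L' that differ modulo U would span a pencil whose
    restriction to a general hyperplane is at most one-dimensional, against Green's bound for
    pencils. The comparison takes place on the hyperplane L = 0 itself, so F_L must not be divisible
    by L modulo U; this is where differentiating powers of L is used. *)

(** * The numerical function of Green's theorem *)

Section GreenFunction.
Local Open Scope nat_scope.

(* The number of monomials of degree [d] in [m] variables, also for [m = 0]. *)
Definition nmon d m := 'C((d + m).-1, d).

Lemma nmon0 m : nmon 0 m = 1.
Proof. by rewrite /nmon bin0. Qed.

Lemma nmonS0 d : nmon d.+1 0 = 0.
Proof. by rewrite /nmon addn0 bin_small. Qed.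

Lemma nmonSS d m : nmon d.+1 m.+1 = nmon d.+1 m + nmon d m.+1.
Proof. by rewrite /nmon addSn addnS /= binS. Qed.

Lemma nmon1 m : nmon 1 m = m.
Proof. by rewrite /nmon add1n bin1. Qed.

Lemma nmon_gt0 d m : 0 < nmon d m.+1.
Proof. by rewrite /nmon addnS /= bin_gt0 leq_addr. Qed.

Lemma nmon_1 d : nmon d 1 = 1.
Proof. by rewrite /nmon addn1 /= binn. Qed.

Lemma leq_nmonS d m : nmon d m <= nmon d m.+1.
Proof. by case: d => [|d]; rewrite ?nmon0 // nmonSS leq_addr. Qed.

Lemma leq_nmon d m1 m2 : m1 <= m2 -> nmon d m1 <= nmon d m2.
Proof.
move=> /subnK <-; elim: (m2 - m1) => //= i /leq_trans->//; exact: leq_nmonS.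
Qed.

Lemma leq_nmonD j i m : nmon j m.+1 <= nmon (i + j) m.+1.
Proof.
elim: i => //= i /leq_trans -> //; rewrite addSn nmonSS; exact: leq_addl.
Qed.

Lemma nmon_ge d m : m <= nmon d.+1 m.
Proof.
elim: m => // m IHm; rewrite nmonSS; have := nmon_gt0 d m; lia.
Qed.

(* [c_(d)|^{-1}_0], also for [c = 0] and [d = 0]. *)
Fixpoint green d c :=
  if d is e.+1 then
    let m := find (fun m => c < nmon d m.+1) (iota 0 c.+1) in
    nmon d m.-1 + green e (c - nmon d m)
  else c.
Arguments green : simpl never.

Lemma green_deg0 c : green 0 c = c.
Proof. by []. Qed.

(** By Pascal's rule the bound on z says exactly that m is the index found by the search in [green];
    [nmon_ge] keeps it within the searched range. *)
Lemma green_lt d m z : z < nmon d m.+1 ->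
  green d.+1 (nmon d.+1 m + z) = nmon d.+1 m.-1 + green d z.
Proof.
set c := nmon d.+1 m + z => ltz; pose a x := c < nmon d.+1 x.+1.
have -> : green d.+1 c = nmon d.+1 (find a (iota 0 c.+1)).-1
    + green d (c - nmon d.+1 (find a (iota 0 c.+1))) by [].
suff -> : find a (iota 0 c.+1) = m by rewrite /c addKn.
have le_mc : m <= c by have := nmon_ge d m; rewrite /c; lia.
have am : a m by rewrite /a /c nmonSS ltn_add2l.
have ltm x : x < m -> ~~ a x.
  move=> /(@leq_nmon d.+1) lexm; rewrite /a -leqNgt /c.
  by rewrite (leq_trans lexm) ?leq_addr.
rewrite -{1}(subnKC le_mc) -addnS iotaD find_cat.
rewrite (_ : has a _ = false) /=; first by rewrite size_iota add0n am addn0.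
apply/hasPn => x; rewrite mem_iota add0n => /andP[_ ltx]; exact: ltm.
Qed.

Lemma green_block0 d c :
  {mz | mz.2 < nmon d mz.1.+1 & c = nmon d.+1 mz.1 + mz.2}.
Proof.
have ex : exists m, c < nmon d.+1 m.+1.
  by exists c; have := nmon_ge d c.+1; lia.
case: (ex_minnP ex) => m ltm minm.
have le : nmon d.+1 m <= c.
  case: m minm {ltm} => [|m] minm; first by rewrite nmonS0.
  by rewrite leqNgt; apply/negP => /minm; lia.
exists (m, c - nmon d.+1 m) => /=; last by lia.
by move: ltm; rewrite nmonSS; lia.
Qed.

Lemma green0 d : green d 0 = 0.
Proof.
elim: d => //= d IHd; have := @green_lt d 0 0 (nmon_gt0 _ _).
by rewrite nmonS0 IHd.
Qed.

Lemma green_nmon d m : green d.+1 (nmon d.+1 m) = nmon d.+1 m.-1.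
Proof.
by have := @green_lt d m 0 (nmon_gt0 _ _); rewrite addn0 green0 addn0.
Qed.

(** The endpoint z = [nmon d m.+1] already belongs to the next block, but both formulas agree there
    unless m = d = 0. Neighbouring blocks thus overlap, which lets unit steps cross them. *)
Lemma green_block d m z : 0 < m + d -> z <= nmon d m.+1 ->
  green d.+1 (nmon d.+1 m + z) = nmon d.+1 m.-1 + green d z.
Proof.
move=> md; rewrite leq_eqVlt => /orP[/eqP->|]; last exact: green_lt.
rewrite -nmonSS green_nmon /=.
case: d m md => [|d] [|m] // _.
- by rewrite nmonSS !nmon0.
- by rewrite green_nmon /= !nmonS0.
- by rewrite green_nmon /= nmonSS.
Qed.

Lemma greenS d c : green d c <= green d c.+1 <= (green d c).+1.
Proof.
elim: d c => [|d IHd] c; first by rewrite !green_deg0 leqnSn leqnn.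
have [[m z] /= ltz ->] := green_block0 d c.
case: (posnP (m + d)) => [/eqP|md].
  rewrite addn_eq0 => /andP[/eqP m0 /eqP d0]; subst m d.
  by case: z ltz => // _; rewrite !nmonS0 !green1.
by rewrite -addnS !green_block //; [have := IHd z; lia | exact: ltnW].
Qed.

Lemma leq_green d c1 c2 : c1 <= c2 -> green d c1 <= green d c2.
Proof.
move=> /subnK <-; elim: (c2 - c1) => //= i /leq_trans -> //.
by rewrite addSn; case/andP: (greenS d (i + c1)).
Qed.

Lemma green_leq_sub d c1 c2 : c1 <= c2 ->
  c1 + green d c2 <= c2 + green d c1.
Proof.
move=> /subnK <-; elim: (c2 - c1) => //= i IHi.
by rewrite addSn; case/andP: (greenS d (i + c1)) IHi; lia.
Qed.

Lemma green1 c : green 1 c = c.-1.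
Proof. by rewrite -{1}[c]nmon1 green_nmon nmon1. Qed.

Lemma green_ltn d c : 0 < c -> green d.+1 c < c.
Proof.
move=> c0; have := @green_leq_sub d.+1 1 c c0.
by have := green_nmon d 1; rewrite nmon_1 nmonS0 => ->; lia.
Qed.

(* The codimension in degree j + k + 1 of a hypersurface of degree k + 1 in a
   projective space with [m] homogeneous coordinates. *)
Definition hmon j k m := nmon (j + k.+1) m - nmon j m.

Lemma leq_nmon_add j k m : 0 < m -> nmon j m <= nmon (j + k) m.
Proof. by case: m => // m _; rewrite addnC leq_nmonD. Qed.

Lemma hmonSS j k m :
  hmon j.+1 k m.+2 = hmon j.+1 k m.+1 + hmon j k m.+2.
Proof.
have := leq_nmon_add j k.+1 (ltn0Sn m.+1).
have := leq_nmon_add j.+1 k.+1 (ltn0Sn m).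
by rewrite /hmon addSn !(nmonSS _ m.+1); lia.
Qed.

Lemma hmon0 k m : hmon 0 k m = nmon k.+1 m - 1.
Proof. by rewrite /hmon nmon0 add0n. Qed.

Lemma hmon1 j k : hmon j k 1 = 0.
Proof. by rewrite /hmon !nmon_1. Qed.

Lemma hmonj0 j m : hmon j 0 m.+1 = nmon j.+1 m.
Proof. by rewrite /hmon addn1 nmonSS addnK. Qed.

(** A hypersurface restricted to a general hyperplane keeps its degree and loses one coordinate.
    Raising k by one puts the single term [nmon (j + k.+2) m.+1] on top of the expansion. *)
Lemma green_hmon j k m : green (j + k.+1) (hmon j k m.+2) = hmon j k m.+1.
Proof.
elim: k => [|k IHk]; first by rewrite !hmonj0 addn1 green_nmon.
rewrite {1}/hmon addnS nmonSS -addnBA ?leq_nmon_add //.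
rewrite -/(hmon j k m.+2) green_block //; last exact: leq_subr.
by rewrite IHk /hmon (addnS j k.+1) nmonSS -addnBA ?leq_nmon_add.
Qed.

(** The bound for a pencil of forms of degree k + 1: two independent forms remain independent on a
    general hyperplane. *)
Lemma green_nmon_sub2 k m :
  green k.+1 (nmon k.+1 m.+3 - 2) = nmon k.+1 m.+2 - 2.
Proof.
elim: k => [|k IHk]; first by rewrite !nmon1 green1; lia.
have h1 := nmon_ge k m.+3; have h2 := nmon_ge k m.+2.
rewrite nmonSS -addnBA; last by lia.
rewrite green_block ?leq_subr ?addnS // IHk /=.
by rewrite (nmonSS k.+1 m.+1) -addnBA; lia.
Qed.

Lemma green_nmonP d m z : z < nmon d.+1 m.+2 -> green d.+1 z < nmon d.+1 m.+1.
Proof.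
move=> ltz; have h := green_hmon 0 d m; rewrite !hmon0 add0n in h.
have := @leq_green d.+1 z (nmon d.+1 m.+2 - 1).
by have := nmon_gt0 d.+1 m; rewrite h; lia.
Qed.

(* [green d] and [x - green d.+1 x] are monotone, so that [green_bound] only has
   to be tested at [x = green d.+1 z + 1]. *)
Lemma green_key d z (g := green d.+1 z) : 0 < z ->
  green d (z - g).-1 + green d.+1 g.+1 < g.+1.
Proof.
rewrite {}/g; elim: d z => [|d IHd] z z0; first by rewrite !green1 green_deg0; lia.
have [[m w] /= ltw dz] := green_block0 d.+1 z.
case: m => [|m] in ltw dz *.
  by move: ltw dz z0; rewrite nmonS0 nmon_1; lia.
have gw : green d.+1 w < nmon d.+1 m.+1 by exact: green_nmonP.
have gz : green d.+2 z = nmon d.+2 m + green d.+1 w.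
  by rewrite dz green_block //= ltnW.
have gz1 : green d.+2 (green d.+2 z).+1 =
    nmon d.+2 m.-1 + green d.+1 (green d.+1 w).+1.
  by rewrite gz -addnS green_block // ?addnS.
have nE : nmon d.+2 m = nmon d.+2 m.-1 + nmon d.+1 m.
  by case: (m) => [|m']; rewrite ?nmonS0 // nmonSS.
(* The shifted leading terms of the two summands on the left add up, by [nE], to the leading term of
   g; what remains is the induction hypothesis for w. *)
have zg : z - green d.+2 z = nmon d.+1 m.+1 + (w - green d.+1 w).
  have := @green_leq_sub d.+1 0 w (leq0n _).
  by rewrite gz dz nmonSS green0; lia.
rewrite gz1 zg.
(* For w = 0 the predecessor of z - g borrows from its leading term, and monotonicity of [green]
   bounds the summand instead. *)
case: (posnP w) => [w0|w0].
  have g1 := green_nmon d 1; rewrite nmon_1 /= nmonS0 in g1.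
  rewrite gz w0 green0 g1 !addn0.
  have := @leq_green d.+1 (nmon d.+1 m.+1).-1 (nmon d.+1 m.+1) (leq_pred _).
  by rewrite green_nmon /=; lia.
have ih := IHd w w0; have gw' := green_ltn d w0.
have le1 := @green_leq_sub d.+1 w (nmon d.+1 m.+2) (ltnW ltw).
rewrite green_nmon [m.+2.-1]/= (nmonSS d m.+1) in le1.
have -> : (nmon d.+1 m.+1 + (w - green d.+1 w)).-1 =
   nmon d.+1 m.+1 + (w - green d.+1 w).-1 by lia.
rewrite green_block //=; last by lia.
by rewrite gz nE; lia.
Qed.

(** Closes the induction for Green's theorem: c and x are the codimensions of V and V_L, and the two
    summands bound those of (V_L)_{L'} and (V : L')_L. *)
Lemma green_bound d x c :
  x <= green d.+1 x + green d (c - x) -> x <= green d.+1 c.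
Proof.
move=> lex; rewrite leqNgt; apply/negP => ltx.
have c0 : 0 < c.
  case: c lex ltx => [|//]; rewrite sub0n !green0 addn0 => lex ltx.
  by have := green_ltn d ltx; lia.
have := green_key d c0; have gc := green_ltn d c0.
have := @green_leq_sub d.+1 _ _ ltx.
have : green d (c - x) <= green d (c - green d.+1 c).-1.
  by apply: leq_green; lia.
by lia.
Qed.

(** * Binomial expansions and the Hilbert function of a hypersurface *)

Lemma binz_pred a i : 0 < a -> binz (a%:Z + (-1)%R)%R (i%:Z + 0)%R = 'C(a.-1, i).
Proof.
case: a => // a _; rewrite /binz addr0.
have -> : (a.+1%:Z + -1)%R = a%:Z by lia.
case: ifP => //= /negP h; rewrite bin_small //; lia.
Qed.

(** The induction passes to tails of an expansion, down to the empty one; the default i in [last]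
    and [head] makes the bounds hold there. The strict bound on r keeps the tail below the next
    block, as [green_lt] requires. *)
Lemma expansion_green i s : size s <= i -> sorted gtn s ->
    (i - (size s).-1 <= last i s) ->
  let r := \sum_(t < size s) 'C(nth 0 s t, i - t) in
  [/\ green i r =
        \sum_(t < size s) binz ((nth 0 s t)%:Z + (-1)%R)%R ((i - t)%N%:Z + 0)%R,
      r < 'C((head i s).+1, i) & i <= head i s].
Proof.
elim: s i => [|a s IHs] [|i] //=.
- by move=> _ _ _; rewrite !big_ord0 green0 bin0.
- by move=> _ _ _; rewrite !big_ord0 green0 bin_gt0 leqnSn.
rewrite ltnS => les path_s last_s.
have sorted_s := path_sorted path_s.
have last_s' : i - (size s).-1 <= last i s.
  by case: s {IHs sorted_s path_s} les last_s => //= b s; lia.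
have [IH1 IH2 IH3] := IHs i les sorted_s last_s'.
rewrite !big_ord_recl /= subn0.
under eq_bigr => t _ do rewrite subSS.
under [in RHS]eq_bigr => t _ do rewrite /bump /= add1n subSS.
have le_ia : i < a.
  case: s path_s last_s IH3 {IHs IH1 IH2 les sorted_s last_s'} => //= b s.
  by case/andP=> ba _ _; lia.
have lt_r : \sum_(t < size s) 'C(nth 0 s t, i - t) < 'C(a, i).
  case: s IH2 path_s {IHs IH1 IH3 les sorted_s last_s' last_s} => /=.
    by move=> _ _; rewrite big_ord0 bin_gt0 ltnW.
  move=> b s /leq_trans lt /andP[ba _]; apply: lt; exact: leq_bin2l.
set r := \sum_(t < _) _ in IH1 lt_r *.
have nmonE : 'C(a, i.+1) = nmon i.+1 (a - i).
  by rewrite /nmon; congr 'C(_, _); lia.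
rewrite binz_pred; last by lia.
have lt_r' : r < nmon i (a - i).+1.
  by rewrite /nmon (_ : (_ + _).-1 = a) //; lia.
split=> //; last by rewrite binS; lia.
rewrite nmonE green_lt // IH1; congr (_ + _).
by rewrite /nmon; congr 'C(_, _); lia.
Qed.

Lemma shifted_expansion_green r i v : shifted_expansion r i 0 (-1) v -> v = green i r.
Proof.
move=> [s [/andP[s0 si] srt lasts ->] ->].
have [|->//] := expansion_green si srt.
by case: s s0 lasts {si srt}.
Qed.

Lemma sum_nmon j k m :
  \sum_(t < k.+1) nmon (j + k.+1 - t) m.+1 = hmon j k m.+2.
Proof.
elim: k => [|k IHk]; first by rewrite big_ord1 subn0 hmonj0 addn1.
rewrite big_ord_recl /= subn0.
under eq_bigr => t _ do rewrite /bump /= add1n addnS subSS.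
by rewrite IHk /hmon (addnS j k.+1) (nmonSS _ m.+1) -addnBA ?leq_nmon_add.
Qed.

(** The binomial coefficient of index t counts monomials of degree d - t in c + 1 variables, and c +
    2 is the number of homogeneous coordinates on the ambient linear space. *)
Lemma hypersurface_expansion j k c h (d := j + k.+1) :
    binomial_expansion h d [seq d + c - t | t <- iota 0 k.+1] ->
  h = hmon j k c.+2.
Proof.
case=> _ _ _ ->; rewrite size_map size_iota -sum_nmon.
apply: eq_bigr => t _.
rewrite (nth_map 0) ?size_iota // nth_iota // add0n /nmon.
by congr 'C(_, _); have := ltn_ord t; lia.
Qed.

End GreenFunction.
(** * General points and maximal rank *)

Section GenericPoints.
Import VectorInternalTheory.
Variable K : fieldType.
Hypothesis Kinf : forall s : seq K, exists x : K, x \notin s.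

Lemma nonroot (q : {poly K}) : q != 0 -> exists t, q.[t] != 0.
Proof.
move=> q0.
have [s [us sz]] : exists s : seq K, uniq s /\ size s = size q.
  elim: (size q) => [|m [s [us sz]]]; first by exists [::].
  by have [x xs] := Kinf s; exists (x :: s); rewrite /= xs us sz.
apply: NNPP => nex.
have rts : all (root q) s.
  by apply/allP => x _; rewrite rootE; apply/negPn/negP => qx; apply: nex; exists x.
by have := max_poly_roots q0 rts us; rewrite sz ltnn.
Qed.

Lemma nonroot_at (q : {poly K}) a : q.[a] != 0 -> q != 0.
Proof. by apply: contraNneq => ->; rewrite horner0. Qed.

(* A substitute for Zariski openness that needs no coordinates on [X]: Zariski
   open sets are line-open, and nonempty line-open sets always meet. *)
Definition line_open (X : lmodType K) (O : X -> Prop) : Prop :=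
  forall x y, O x ->
  exists2 q : {poly K}, q.[0] != 0 & forall t, q.[t] != 0 -> O (x + t *: y).

Definition generic (X : lmodType K) (P : X -> Prop) : Prop :=
  exists O, [/\ line_open O, exists x, O x & forall x, O x -> P x].

Lemma generic_ex (X : lmodType K) (P : X -> Prop) : generic P -> exists x, P x.
Proof. by move=> [O [_ [x Ox] OP]]; exists x; apply: OP. Qed.

Lemma generic_mono (X : lmodType K) (P Q : X -> Prop) :
  (forall x, P x -> Q x) -> generic P -> generic Q.
Proof. by move=> PQ [O [lO nO OP]]; exists O; split=> // x /OP/PQ. Qed.

Lemma generic_and (X : lmodType K) (P Q : X -> Prop) :
  generic P -> generic Q -> generic (fun x => P x /\ Q x).
Proof.
move=> [O1 [lO1 [x1 Ox1] OP]] [O2 [lO2 [x2 Ox2] OQ]].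
exists (fun x => O1 x /\ O2 x); split; last by move=> x [/OP ? /OQ ?].
  move=> x y [O1x O2x].
  have [[q1 q10 h1] [q2 q20 h2]] := (lO1 x y O1x, lO2 x y O2x).
  exists (q1 * q2) => [|t]; rewrite hornerM.
    exact: mulf_neq0.
  by rewrite mulf_eq0 negb_or => /andP[/h1 ? /h2].
(* On the line joining a point of each set both conditions are nonzero polynomials, so they have a
   common nonroot. The second one is parametrised from the other end, hence the composition with 1 -
   X. *)
have [q1 q10 h1] := lO1 _ (x2 - x1) Ox1.
have [q2 q20 h2] := lO2 _ (x1 - x2) Ox2.
have c20 : (q2 \Po (1 - 'X)) != 0.
  by apply: (@nonroot_at _ 1); rewrite horner_comp !hornerE subrr.
have [t] := nonroot (mulf_neq0 (nonroot_at q10) c20).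
rewrite hornerM mulf_eq0 negb_or => /andP[/h1 O1t].
rewrite horner_comp !hornerE => /h2.
rewrite (_ : x2 + _ = x1 + t *: (x2 - x1)) => [O2t|].
  by eexists; split; [exact: O1t|].
rewrite scalerBl scale1r -scalerN opprB addrA; congr (_ + _).
by rewrite addrC subrK.
Qed.

Lemma generic_slices (X Y : lmodType K) (P : X * Y -> Prop) :
  generic P -> generic (fun y => generic (fun x => P (x, y))).
Proof.
move=> [O [lO [[x0 y0] O0] OP]].
exists (fun y => exists x, O (x, y)); split; last 1 first.
- move=> y [x Ox]; exists (fun x' => O (x', y)); split; last by move=> ? /OP.
    move=> x' x'' Ox'; have [q q0 h] := lO _ (x'', 0) Ox'; exists q => // t /h.
    by rewrite -[_ + _]/(x' + t *: x'', y + t *: 0) scaler0 addr0.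
  by exists x.
- move=> y y' [x' Oxy]; have [q q0 h] := lO _ (0, y') Oxy; exists q => // t /h.
  by rewrite -[_ + _]/(x' + t *: 0, y + t *: y') scaler0 addr0; exists x'.
by exists y0, x0.
Qed.

Lemma generic_swap (X Y : lmodType K) (P : X * Y -> Prop) :
  generic P -> generic (fun p : Y * X => P (p.2, p.1)).
Proof.
move=> [O [lO [[x0 y0] O0] OP]].
exists (fun p => O (p.2, p.1)); split=> [[y x] [y' x'] /=||p /OP//].
  by move=> Oxy; have [q q0 h] := lO _ (x', y') Oxy; exists q.
by exists (y0, x0).
Qed.

Lemma generic_snd (X Y : lmodType K) (P : Y -> Prop) :
  generic P -> generic (fun p : X * Y => P p.2).
Proof.
move=> [O [lO [y0 O0] OP]].
exists (fun p => O p.2); split=> [[x y] [x' y'] /=||p /OP//].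
  by move=> Oy; have [q q0 h] := lO _ y' Oy; exists q.
by exists (0, y0).
Qed.

Lemma generic_fst (X Y : lmodType K) (P : X -> Prop) :
  generic P -> generic (fun p : X * Y => P p.1).
Proof. by move=> /(@generic_snd Y)/generic_swap. Qed.

Lemma generic_diag (X : lmodType K) (P Q : X -> Prop) :
  generic P -> generic Q -> generic (fun p : X * X => P p.1 /\ Q p.2).
Proof.
by move=> /(@generic_fst _ X) gP /(@generic_snd X) gQ; apply: generic_and.
Qed.

(** Both f x0 and f (x0 + t x) lie in V for some t != 0, hence so does their difference t f x. *)
Lemma generic_memv (X : lmodType K) (vT : vectType K) (f : X -> vT)
    (V : {vspace vT}) :
    (forall t x y, f (x + t *: y) = f x + t *: f y) ->
  generic (fun x => f x \in V) -> forall x, f x \in V.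
Proof.
move=> flin [O [lO [x0 Ox0] OP]] x.
have [q q0 h] := lO x0 x Ox0.
have Xn0 : 'X != 0 :> {poly K} by rewrite polyX_eq0.
have [t] := nonroot (mulf_neq0 (nonroot_at q0) Xn0).
rewrite hornerM mulf_eq0 negb_or hornerX => /andP[/h/OP ft t0].
have := memvB ft (OP _ Ox0); rewrite flin addrC addKr.
by move/(memvZ t^-1); rewrite scalerA mulVf ?scale1r.
Qed.

(** * Polynomial families of subspaces and semicontinuity of the dimension *)

Definition poly_space (vT : vectType K) (f : K -> {vspace vT}) : Prop :=
  exists r (P : 'M[{poly K}]_(r, dim vT)),
    forall t, (vs2mx (f t) :=: map_mx (horner_eval t) P)%MS.

Definition poly_vec (vT : vectType K) (w : K -> vT) : Prop :=
  exists P : 'rV[{poly K}]_(dim vT), forall t, v2r (w t) = map_mx (horner_eval t) P.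

Lemma horner_eval_polyC m p (A : 'M[K]_(m, p)) t :
  map_mx (horner_eval t) (map_mx polyC A) = A.
Proof. by apply/matrixP => i j; rewrite !mxE /horner_eval hornerC. Qed.

(** The constant matrices C and B cut an identity matrix of size the rank out of P(0). The
    polynomial is det (C P B): it is 1 at 0, and wherever it does not vanish P has at least that
    rank. *)
Lemma poly_rank_lb r p (P : 'M[{poly K}]_(r, p)) :
  exists2 q : {poly K}, q.[0] != 0 &
    forall t, q.[t] != 0 ->
      (\rank (map_mx (horner_eval 0) P) <= \rank (map_mx (horner_eval t) P))%N.
Proof.
set A := map_mx (horner_eval 0) P.
pose C := row_base A *m pinvmx A; pose B := pinvmx (row_base A).
have CAB : C *m A *m B = 1%:M.
  by rewrite mulmxKpV ?eq_row_base // mulmxVp // row_base_free.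
have E t : map_mx (horner_eval t) (map_mx polyC C *m P *m map_mx polyC B)
    = C *m map_mx (horner_eval t) P *m B.
  by rewrite !map_mxM /= !horner_eval_polyC.
exists (\det (map_mx polyC C *m P *m map_mx polyC B)).
  by rewrite -[_.[0]]/(horner_eval 0 _) -det_map_mx E CAB det1 oner_eq0.
move=> t; rewrite -[_.[t]]/(horner_eval t _) -det_map_mx E => dt.
have: C *m map_mx (horner_eval t) P *m B \in unitmx by rewrite unitmxE unitfE.
rewrite -row_free_unit => /eqP <-.
exact: leq_trans (mxrankM_maxl _ _) (mxrankM_maxr _ _).
Qed.

Lemma poly_space_dim_lb (vT : vectType K) (f : K -> {vspace vT}) : poly_space f ->
  exists2 q : {poly K}, q.[0] != 0 &
    forall t, q.[t] != 0 -> (\dim (f 0%R) <= \dim (f t))%N.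
Proof.
move=> [r [P fP]]; have [q q0 h] := poly_rank_lb P; exists q => // t /h.
by rewrite /dimv !fP.
Qed.

Lemma poly_space_const (vT : vectType K) (V : {vspace vT}) : poly_space (fun=> V).
Proof. by exists _, (map_mx polyC (vs2mx V)) => t; rewrite horner_eval_polyC. Qed.

Lemma poly_space_add (vT : vectType K) (f g : K -> {vspace vT}) :
  poly_space f -> poly_space g -> poly_space (fun t => f t + g t)%VS.
Proof.
move=> [r [P fP]] [s [Q gQ]]; exists (r + s)%N, (col_mx P Q) => t.
rewrite map_col_mx; apply: eqmx_trans (mx2vsK _) _.
apply: eqmx_trans (adds_eqmx (fP t) (gQ t)) _; exact: addsmxE.
Qed.

Lemma poly_space_line (vT : vectType K) (w : K -> vT) :
  poly_vec w -> poly_space (fun t => <[w t]>%VS).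
Proof.
move=> [P wP]; exists 1%N, P => t; rewrite -wP; exact: mx2vsK.
Qed.

Lemma v2r_lfun (aT rT : vectType K) (f : 'Hom(aT, rT)) u :
  v2r (f u) = v2r u *m f2mx f.
Proof. by rewrite unlock /= r2vK. Qed.

Lemma f2mx_line (aT rT : vectType K) (f g : 'Hom(aT, rT)) t :
  f2mx (f + t *: g) = f2mx f + t *: f2mx g.
Proof.
apply/row_matrixP => i; rewrite !rowE -(r2vK (delta_mx 0 i)) -v2r_lfun.
by rewrite add_lfunE scale_lfunE linearD linearZ /= !v2r_lfun mulmxDr scalemxAr.
Qed.

Lemma horner_eval_line m p (A B : 'M[K]_(m, p)) t :
  map_mx (horner_eval t) (map_mx polyC A + 'X *: map_mx polyC B) = A + t *: B.
Proof.
by apply/matrixP => i j; rewrite !mxE /horner_eval !hornerE.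
Qed.

Lemma poly_space_limg (aT rT : vectType K) (f g : 'Hom(aT, rT)) (U : K -> {vspace aT}) :
  poly_space U -> poly_space (fun t => (f + t *: g) @: U t)%VS.
Proof.
move=> [r [P UP]].
exists r, (P *m (map_mx polyC (f2mx f) + 'X *: map_mx polyC (f2mx g))) => t.
rewrite map_mxM /= horner_eval_line -f2mx_line unlock.
apply: eqmx_trans (mx2vsK _) _; exact: eqmxMr.
Qed.

Lemma poly_vec_const (vT : vectType K) (v : vT) : poly_vec (fun=> v).
Proof. by exists (map_mx polyC (v2r v)) => t; rewrite horner_eval_polyC. Qed.

Lemma poly_vecD (vT : vectType K) (v w : K -> vT) :
  poly_vec v -> poly_vec w -> poly_vec (fun t => v t + w t).
Proof.
move=> [P vP] [Q wQ]; exists (P + Q) => t.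
by rewrite map_mxD -vP -wQ linearD.
Qed.

Lemma poly_vec_lfun (aT rT : vectType K) (f g : 'Hom(aT, rT)) (w : K -> aT) :
  poly_vec w -> poly_vec (fun t => (f + t *: g) (w t)).
Proof.
move=> [P wP].
exists (P *m (map_mx polyC (f2mx f) + 'X *: map_mx polyC (f2mx g))) => t.
by rewrite map_mxM /= horner_eval_line -f2mx_line -wP v2r_lfun.
Qed.

Section PolySub.
Variables (X : lmodType K) (vT : vectType K).
Implicit Types f g : X -> {vspace vT}.

Definition poly_sub f : Prop := forall x y, poly_space (fun t => f (x + t *: y)).

Definition max_at f x : Prop := forall x', (\dim (f x') <= \dim (f x))%N.

(** Dimensions are bounded, so the maximum is attained, and semicontinuity along lines makes the set
    of maximal points line-open. *)
Lemma generic_max f : poly_sub f -> generic (max_at f).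
Proof.
move=> pf; exists (max_at f); split=> // [x y mx|].
  have [q] := poly_space_dim_lb (pf x y); rewrite scale0r addr0 => q0 h.
  exists q => // t /h le x'; exact: leq_trans (mx x') le.
have [m le] := ubnP (\dim {:vT} - \dim (f 0%R)); elim: m 0 le => // m IHm x.
rewrite ltnS => le; case: (classic (max_at f x)) => [|nm]; first by exists x.
have [x' lt] : exists x', (\dim (f x) < \dim (f x'))%N.
  apply: NNPP => nex; apply: nm => z; rewrite leqNgt.
  by apply/negP => lt; apply: nex; exists z.
have lef := dimvS (subvf (f x')).
by apply: (IHm x'); lia.
Qed.

Lemma generic_dim f : poly_sub f -> exists r, generic (fun x => \dim (f x) = r).
Proof.
move=> pf; have gm := generic_max pf; have [x mx] := generic_ex gm.
exists (\dim (f x)); apply: generic_mono gm => x' mx'.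
by apply/eqP; rewrite eqn_leq mx mx'.
Qed.

(* At a point where the dimension of f is maximal, f is stable under limits
   along lines. *)
Lemma max_at_limit f x y (w : K -> vT) : poly_sub f -> max_at f x -> poly_vec w ->
  (forall t, t != 0 -> w t \in f (x + t *: y)) -> w 0 \in f x.
Proof.
move=> pf mx pw wf; apply/negPn/negP => w0.
(* Otherwise adding w t would push the dimension above the maximum at t = 0, hence by semicontinuity
   also at some t != 0, where w t already lies in f. *)
have pg := poly_space_add (pf x y) (poly_space_line pw).
have [q q0 h] := poly_space_dim_lb pg.
have Xn0 : 'X != 0 :> {poly K} by rewrite polyX_eq0.
have [t] := nonroot (mulf_neq0 (nonroot_at q0) Xn0).
rewrite hornerM mulf_eq0 negb_or hornerX => /andP[/h le t0].
have lt : (\dim (f x) < \dim (f x + <[w 0%R]>))%N.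
  rewrite (ltn_leqif (dimv_leqif_sup (addvSl _ _))) subv_add subvv /=.
  by rewrite -memvE.
move: le; rewrite scale0r addr0 (addv_idPl (wf t t0 : _ <= _)%VS).
by rewrite leqNgt (leq_ltn_trans (mx _) lt).
Qed.

Lemma poly_sub_const V : poly_sub (fun=> V).
Proof. by move=> x y; apply: poly_space_const. Qed.

Lemma poly_sub_add f g : poly_sub f -> poly_sub g -> poly_sub (fun x => f x + g x)%VS.
Proof. by move=> pf pg x y; apply: poly_space_add. Qed.

End PolySub.

Lemma poly_sub_limg (X : lmodType K) (aT rT : vectType K) (f : X -> {vspace aT})
    (m : X -> 'Hom(aT, rT)) :
    (forall t x y, m (x + t *: y) = m x + t *: m y) ->
  poly_sub f -> poly_sub (fun x => m x @: f x)%VS.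
Proof.
move=> mlin pf x y; have [r [P fP]] := poly_space_limg (m x) (m y) (pf x y).
by exists r, P => t; rewrite mlin.
Qed.

End GenericPoints.

(** * Codimensions of subspaces *)

Definition codim (K : fieldType) (vT : vectType K) (V : {vspace vT}) : nat :=
  (\dim {:vT} - \dim V)%N.

Section Codim.
Variables (K : fieldType) (vT : vectType K).
Implicit Types U V : {vspace vT}.
Local Open Scope nat_scope.

Lemma dim_codim V : \dim V + codim V = \dim {:vT}.
Proof. by rewrite subnKC ?dimvS ?subvf. Qed.

Lemma codimS U V : (U <= V)%VS -> codim V <= codim U.
Proof. by move=> /dimvS; rewrite /codim; lia. Qed.

Lemma codimS_eq U V : (U <= V)%VS -> codim U <= codim V -> U = V.
Proof.
move=> sUV le; apply/eqP; rewrite eqEdim sUV.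
by have := dim_codim U; have := dim_codim V; lia.
Qed.

Lemma codim_eq0 V : codim V = 0 -> V = fullv.
Proof. by move=> h; apply: codimS_eq; rewrite ?subvf ?h. Qed.

Lemma codim_full : codim (fullv : {vspace vT}) = 0.
Proof. by rewrite /codim subnn. Qed.

Lemma codim_lt U v : v \notin U -> codim (U + <[v]>)%VS < codim U.
Proof.
move=> vU; rewrite ltn_neqAle codimS ?addvSl // andbT.
apply: contra vU => /eqP e.
have eU := codimS_eq (addvSl U <[v]>) (eq_leq (esym e)).
by rewrite eU memvE addvSr.
Qed.

Lemma codim_line U v : codim U <= (codim (U + <[v]>)%VS).+1.
Proof.
have := dimv_sum_cap U <[v]>; have := dim_vline v; have := dim_codim U.
by have := dim_codim (U + <[v]>)%VS; case: (v != 0%R); lia.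
Qed.

Lemma codim_addv U v : v \notin U -> codim U = (codim (U + <[v]>)%VS).+1.
Proof. by move=> /codim_lt; have := codim_line U v; lia. Qed.

End Codim.

Section CodimPreim.
Local Open Scope nat_scope.

Lemma codim_preim (K : fieldType) (aT vT : vectType K) (f : 'Hom(aT, vT))
    (V : {vspace vT}) :
  codim (f @^-1: V)%VS + \dim V = \dim (V + limg f)%VS.
Proof.
have h1 := limg_ker_dim f (f @^-1: V); have h2 := limg_ker_dim f fullv.
rewrite capfv in h2.
rewrite (capv_idPr _) in h1; last by rewrite -lpreim0 lpreimS ?sub0v.
rewrite -lpreim_cap_limg lpreimK ?capvSr // in h1.
have := dimv_sum_cap V (limg f); have := dim_codim (f @^-1: V)%VS.
by rewrite lpreim_cap_limg in h1; lia.
Qed.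

(** The exact sequence from aT / f^-1 V through vT / V to vT / (V + im f); for multiplication by L
    it relates V, V : L and V_L. *)
Lemma codim_preim_add (K : fieldType) (aT vT : vectType K) (f : 'Hom(aT, vT))
    (V : {vspace vT}) :
  codim V = codim (V + limg f)%VS + codim (f @^-1: V)%VS.
Proof.
have := codim_preim f V; have := dim_codim V.
by have := dim_codim (V + limg f)%VS; lia.
Qed.

End CodimPreim.

(** * Green's theorem and its extremal case *)

Section GradedAlgebra.
Variable K : fieldType.
Hypothesis Kinf : forall s : seq K, exists x : K, x \notin s.
Hypothesis Kchar0 : [pchar K] =i pred0.
Variable S : nat -> vectType K.
Variable mul : forall d, S 1 -> 'Hom(S d, S d.+1).
Hypothesis mul_line : forall d t x y, mul d (x + t *: y) = mul d x + t *: mul d y.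
Hypothesis mulC : forall d L L' g,
  mul d.+1 L (mul d L' g) = mul d.+1 L' (mul d L g).
Variable one : S 0.
Hypothesis mul_one : forall L, mul 0 L one = L.
Hypothesis S0_line : forall g, exists a, g = a *: one.
Hypothesis S_gen : forall d (V : {vspace S d.+1}),
  (forall L g, mul d L g \in V) -> V = fullv.
Hypothesis dimS : forall d, \dim {:S d} = nmon d (\dim {:S 1}).

Lemma mulDl d x y : mul d (x + y) = mul d x + mul d y.
Proof. by have := mul_line d 1 x y; rewrite !scale1r. Qed.

Lemma mul0l d : mul d 0 = 0.
Proof. by apply: (addrI (mul d 0)); rewrite -mulDl !addr0. Qed.

Lemma mulZl d t x : mul d (t *: x) = t *: mul d x.
Proof. by rewrite -[t *: x]add0r mul_line mul0l add0r. Qed.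

Definition hyp (L : S 1) (d : nat) : {vspace S d} :=
  if d is e.+1 then limg (mul e L) else 0%VS.
Arguments hyp : simpl never.

Definition up d (V : {vspace S d}) : {vspace S d.+1} :=
  (\sum_(i < \dim {:S 1}) mul d (vbasis fullv)`_i @: V)%VS.

Lemma mem_up d (V : {vspace S d}) L g : g \in V -> mul d L g \in up V.
Proof.
move=> gV; rewrite (coord_vbasis (memvf L)).
have -> : forall (r : seq 'I_(\dim {:S 1})) (a : 'I_(\dim {:S 1}) -> S 1),
    mul d (\sum_(i <- r) a i) g = \sum_(i <- r) mul d (a i) g.
  move=> r a; elim: r => [|i r IHr]; first by rewrite !big_nil mul0l zero_lfunE.
  by rewrite !big_cons mulDl add_lfunE IHr.
apply: memv_sumr => i _; rewrite mulZl scale_lfunE -linearZ /=.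
by apply: memv_img; apply: memvZ.
Qed.

Lemma up_subP d (V : {vspace S d}) (W : {vspace S d.+1}) :
  (forall L g, g \in V -> mul d L g \in W) <-> (up V <= W)%VS.
Proof.
split=> [h | h L g gV]; last exact: subvP h _ (mem_up L gV).
by apply/subv_sumP => i _; apply/subvP => _ /memv_imgP[g gV ->]; apply: h.
Qed.

Lemma upS d (V W : {vspace S d}) : (V <= W)%VS -> (up V <= up W)%VS.
Proof.
move=> /subvP sVW; apply/up_subP => L g /sVW; exact: mem_up.
Qed.

Lemma up_add d (V W : {vspace S d}) : up (V + W) = (up V + up W)%VS.
Proof.
apply: subv_anti; rewrite (subv_add (up V)) !upS ?addvSl ?addvSr // !andbT.
apply/up_subP => L _ /memv_addP[v vV [w wW ->]].
by rewrite linearD memv_add ?mem_up.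
Qed.

Lemma up_full d : up (fullv : {vspace S d}) = fullv.
Proof. by apply: S_gen => L g; apply: mem_up; apply: memvf. Qed.

Lemma generic_up d (V : {vspace S d}) (W : {vspace S d.+1}) :
  generic (fun L => (mul d L @: V <= W)%VS) -> (up V <= W)%VS.
Proof.
move=> gV; apply/up_subP => L g gV0.
have glin t x y : mul d (x + t *: y) g = mul d x g + t *: mul d y g.
  by rewrite mul_line add_lfunE scale_lfunE.
apply: (generic_memv Kinf (f := fun L => mul d L g) glin).
by apply: generic_mono gV => L' /subvP; apply; apply: memv_img.
Qed.

Definition colon d (V : {vspace S d.+1}) (L : S 1) : {vspace S d} :=
  (mul d L @^-1: V)%VS.

Lemma mem_colon d (V : {vspace S d.+1}) L g : (g \in colon V L) = (mul d L g \in V).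
Proof. by rewrite memv_preim. Qed.

Lemma codim_hyp_colon d (V : {vspace S d.+1}) L :
  codim V = (codim (V + hyp L d.+1)%VS + codim (colon V L))%N.
Proof. exact: codim_preim_add. Qed.

Lemma poly_sub_hyp (X : lmodType K) (p : X -> S 1) d :
    (forall t x y, p (x + t *: y) = p x + t *: p y) ->
  poly_sub (fun x => hyp (p x) d).
Proof.
case: d => [|d] plin; first exact: poly_sub_const.
apply: poly_sub_limg; last exact: poly_sub_const.
by move=> t x y; rewrite plin mul_line.
Qed.

Lemma generic_codim (X : lmodType K) d (f : X -> {vspace S d}) :
  poly_sub f -> exists r, generic (fun x => codim (f x) = r).
Proof.
move=> /generic_dim[r gr]; exists (\dim {:S d} - r)%N.
by apply: generic_mono gr => x <-.
Qed.

(** * Restriction to general hyperplanes and Green's bound *)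

Definition general_codim d (V : {vspace S d}) (r : nat) : Prop :=
  generic (fun L => codim (V + hyp L d)%VS = r).

(** If the codimension does not drop, V contains all multiples of a general L, and these span the
    whole degree. *)
Lemma general_codim_lt d (V : {vspace S d.+1}) r :
  general_codim V r -> (r < codim V \/ codim V = 0)%N.
Proof.
move=> gr; have [L rE] := generic_ex gr.
have := codimS (addvSl V (hyp L d.+1)); rewrite rE leq_eqVlt.
case/orP=> [/eqP e|]; [right|by left].
suff -> : V = fullv by rewrite codim_full.
apply/eqP; rewrite eqEsubv subvf -up_full.
apply: generic_up; apply: generic_mono gr => L' r'E.
have eV := codimS_eq (addvSl V (hyp L' d.+1)).
by rewrite eV ?addvSr // r'E e.
Qed.

Definition pair_codims d (V : {vspace S d.+2}) (r a b : nat) (L L' : S 1) :=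
  [/\ codim (V + hyp L d.+2)%VS = r,
      codim (V + hyp L d.+2 + hyp L' d.+2)%VS = a
    & codim (colon V L + hyp L' d.+1)%VS = b].

Lemma generic_pair_codims d (V : {vspace S d.+2}) r : general_codim V r ->
  exists a b, generic (fun p : S 1 * S 1 =>
    pair_codims V r a b p.1 p.2 /\ pair_codims V r a b p.2 p.1).
Proof.
move=> gr.
have lin1 t (x y : S 1 * S 1) : (x + t *: y).1 = x.1 + t *: y.1 by [].
have lin2 t (x y : S 1 * S 1) : (x + t *: y).2 = x.2 + t *: y.2 by [].
have [a ga] : exists a, generic (fun p : S 1 * S 1 =>
    codim (V + hyp p.1 d.+2 + hyp p.2 d.+2)%VS = a).
  apply: generic_codim; apply: poly_sub_add; last exact: poly_sub_hyp lin2.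
  apply: poly_sub_add; [exact: poly_sub_const | exact: poly_sub_hyp lin1].
(* A colon space need not vary polynomially with L, so b is not obtained from a family of colons. It
   is recovered from the generic dimension of V + L L' S_d, which measures the codimension of (V :
   L) : L'. *)
have [m gm] : exists m, generic (fun p : S 1 * S 1 =>
    \dim (V + mul d.+1 p.1 @: (mul d p.2 @: fullv))%VS = m).
  apply: generic_dim; apply: poly_sub_add; first exact: poly_sub_const.
  apply: poly_sub_limg; first by move=> t x y; rewrite lin1 mul_line.
  apply: poly_sub_limg; last exact: poly_sub_const.
  by move=> t x y; rewrite lin2 mul_line.
pose b := (codim V - r - (m - \dim V))%N.
have gp : generic (fun p : S 1 * S 1 => pair_codims V r a b p.1 p.2).
  apply: generic_mono (generic_and Kinf (generic_fst _ gr) (generic_and Kinf ga gm)).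
  move=> [L L'] /= [rE [aE mE]]; split=> //.
  have := codim_hyp_colon V L; have := codim_hyp_colon (colon V L) L'.
  have := codim_preim (mul d.+1 L \o mul d L')%VF V.
  rewrite limg_comp mE rE.
  have -> : ((mul d.+1 L \o mul d L') @^-1: V)%VS = colon (colon V L) L'.
    by apply/vspaceP => g; rewrite -memv_preim comp_lfunE !mem_colon.
  by rewrite /b; lia.
exists a, b; apply: (generic_and Kinf gp); exact: generic_swap gp.
Qed.

Lemma hyp_sub_colon d (V : {vspace S d.+2}) L L' :
  (colon V L' + hyp L d.+1 <= colon (V + hyp L d.+2) L')%VS.
Proof.
rewrite subv_add; apply/andP; split; apply/subvP => g.
  by rewrite !mem_colon => h; apply: subvP (addvSl _ _) _ h.
case/memv_imgP => f _ ->; rewrite mem_colon mulC.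
by apply: subvP (addvSr _ _) _ _; apply: memv_img; apply: memvf.
Qed.

Lemma pair_codims_leq d (V : {vspace S d.+2}) r a b L L' :
  pair_codims V r a b L L' -> pair_codims V r a b L' L -> (r <= a + b)%N.
Proof.
move=> [rE aE _] [_ _ bE]; have := codimS (hyp_sub_colon V L L').
by have := codim_hyp_colon (V + hyp L d.+2)%VS L'; lia.
Qed.

Lemma pair_codims_general d (V : {vspace S d.+2}) r a b :
    generic (fun p : S 1 * S 1 =>
      pair_codims V r a b p.1 p.2 /\ pair_codims V r a b p.2 p.1) ->
  generic (fun L => [/\ codim (V + hyp L d.+2)%VS = r,
    general_codim (V + hyp L d.+2)%VS a & general_codim (colon V L) b]).
Proof.
move=> /generic_slices; apply: generic_mono => L g; split.
- by have [L' [_ []]] := generic_ex g.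
- by apply: generic_mono g => L' [_ []].
by apply: generic_mono g => L' [_ []].
Qed.

Lemma green_restriction d (V : {vspace S d}) r :
  general_codim V r -> (r <= green d (codim V))%N.
Proof.
elim: d V r => [|[|d] IHd] V r gr.
- by have [L <-] := generic_ex gr; rewrite addv0 green_deg0.
- rewrite green1; case: (general_codim_lt gr) (generic_ex gr) => [|V0 [L]]; first lia.
  by rewrite (codim_eq0 V0) sumfv codim_full => <-.
(* Inner induction on the codimension: V + (L) stays in this degree but has smaller codimension,
   while V : L falls under the outer induction on the degree. *)
have [m] := ubnP (codim V); elim: m V r gr => // m IHm V r gr.
rewrite ltnS => le; case: (general_codim_lt gr) => [ltr|V0]; last first.
  have [L] := generic_ex gr.
  by rewrite (codim_eq0 V0) sumfv codim_full => <-.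
have [a [b g]] := generic_pair_codims gr.
have [p [p1 p2]] := generic_ex g.
have rab := pair_codims_leq p1 p2.
have [L [rE ga gb]] := generic_ex (pair_codims_general g).
apply: green_bound; apply: (leq_trans rab); apply: leq_add.
  by have := IHm _ _ ga; rewrite rE; apply; apply: leq_trans ltr le.
have := IHd _ _ gb; have := codim_hyp_colon V L; rewrite rE => ->.
by rewrite addKn.
Qed.

(** Green's bound gives a' <= a and b' <= b for the generic values, and r <= a' + b'; so r = a + b
    forces equality. Thus V : L is extremal whenever the numerical function is additive at V. *)
Lemma generic_extremal d (V : {vspace S d.+2}) r a b :
    general_codim V r -> green d.+2 r = a -> green d.+1 (codim V - r) = b ->
    r = (a + b)%N ->
  generic (fun p : S 1 * S 1 =>
    pair_codims V r a b p.1 p.2 /\ pair_codims V r a b p.2 p.1).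
Proof.
move=> gr aE bE rE; have [a' [b' g]] := generic_pair_codims gr.
have [p [p1 p2]] := generic_ex g.
have rab := pair_codims_leq p1 p2.
have [L [rLE ga gb]] := generic_ex (pair_codims_general g).
have := green_restriction ga; have := green_restriction gb.
have -> : codim (colon V L) = (codim V - r)%N.
  by have := codim_hyp_colon V L; lia.
rewrite rLE aE bE => leb lea.
have [-> ->] : a = a' /\ b = b' by lia.
exact: g.
Qed.

(** * Ideals generated by linear forms *)

Definition idl (U : {vspace S 1}) (d : nat) : {vspace S d} :=
  if d is e.+1 then (\sum_(i < \dim U) mul e (vbasis U)`_i @: fullv)%VS else 0%VS.
Arguments idl : simpl never.

Lemma mem_idl (U : {vspace S 1}) d u g : u \in U -> mul d u g \in idl U d.+1.
Proof.
move=> uU; rewrite (coord_vbasis uU).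
have -> : forall (r : seq 'I_(\dim U)) (a : 'I_(\dim U) -> S 1),
    mul d (\sum_(i <- r) a i) g = \sum_(i <- r) mul d (a i) g.
  move=> r a; elim: r => [|i r IHr]; first by rewrite !big_nil mul0l zero_lfunE.
  by rewrite !big_cons mulDl add_lfunE IHr.
apply: memv_sumr => i _; rewrite mulZl scale_lfunE -linearZ /=.
by apply: memv_img; apply: memvf.
Qed.

Lemma idl_subP (U : {vspace S 1}) d (W : {vspace S d.+1}) :
  (forall u g, u \in U -> mul d u g \in W) <-> (idl U d.+1 <= W)%VS.
Proof.
split=> [h | h u g uU]; last exact: subvP h _ (mem_idl g uU).
apply/subv_sumP => i _; apply/subvP => _ /memv_imgP[g _ ->]; apply: h.
by apply: vbasis_mem; rewrite mem_nth ?size_tuple.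
Qed.

Lemma idl_line L d : idl <[L]> d = hyp L d.
Proof.
case: d => // d; apply: subv_anti; apply/andP; split.
  apply/idl_subP => _ g /vlineP[a ->].
  by rewrite mulZl scale_lfunE -linearZ /= memv_img ?memvf.
by apply/subvP => _ /memv_imgP[g _ ->]; apply: mem_idl (memv_line L).
Qed.

Lemma idlS U U' d : (U <= U')%VS -> (idl U d <= idl U' d)%VS.
Proof.
case: d => // d /subvP sUU'; apply/idl_subP => u g /sUU'; exact: mem_idl.
Qed.

Lemma idl_add U U' d : idl (U + U') d = (idl U d + idl U' d)%VS.
Proof.
apply: subv_anti; rewrite (subv_add (idl U d)) !idlS ?addvSl ?addvSr // !andbT.
case: d => [|d]; first exact: sub0v.
apply/idl_subP => _ g /memv_addP[u uU [v vU' ->]].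
by rewrite mulDl add_lfunE memv_add ?mem_idl.
Qed.

Lemma idl_add_line U L d : idl (U + <[L]>) d = (idl U d + hyp L d)%VS.
Proof. by rewrite idl_add idl_line. Qed.

Lemma hyp_sub_idl (U : {vspace S 1}) L d : L \in U -> (hyp L d <= idl U d)%VS.
Proof. by rewrite -idl_line => LU; apply: idlS. Qed.

Lemma idl0 d : idl 0 d = 0%VS.
Proof.
case: d => // d; apply/eqP; rewrite -subv0; apply/idl_subP => u g.
by rewrite memv0 => /eqP ->; rewrite mul0l zero_lfunE mem0v.
Qed.

Lemma idl_full d : idl fullv d.+1 = fullv.
Proof. by apply: S_gen => L g; apply: mem_idl; apply: memvf. Qed.

Lemma idl1 U : idl U 1 = U.
Proof.
apply: subv_anti; apply/andP; split.
  apply/idl_subP => u g uU; have [a ->] := S0_line g.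
  by rewrite linearZ /= mul_one memvZ.
by apply/subvP => u uU; rewrite -(mul_one u); apply: mem_idl.
Qed.

Lemma up_idl_sub U d : (up (idl U d) <= idl U d.+1)%VS.
Proof.
apply/up_subP => L; case: d => [|d] g.
  by rewrite memv0 => /eqP ->; rewrite linear0 mem0v.
rewrite -mem_colon; move: g; apply/subvP/idl_subP => u g uU.
by rewrite mem_colon mulC; apply: mem_idl.
Qed.

Lemma up_idl U d : up (idl U d.+1) = idl U d.+2.
Proof.
apply: subv_anti; rewrite up_idl_sub; apply/idl_subP => u g uU.
rewrite -mem_colon.
have -> : colon (up (idl U d.+1)) u = fullv; last exact: memvf.
by apply: S_gen => L f; rewrite mem_colon mulC mem_up ?mem_idl.
Qed.

Lemma up_hyp L d : (up (hyp L d) <= hyp L d.+1)%VS.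
Proof. by rewrite -!idl_line up_idl_sub. Qed.

Lemma idl_sub_colon U L d : (idl U d <= colon (idl U d.+1) L)%VS.
Proof.
apply/subvP => g gU; rewrite mem_colon.
exact: subvP (up_idl_sub U d) _ (mem_up _ gU).
Qed.

Lemma codim_gt0P (vT : vectType K) (U : {vspace vT}) : (0 < codim U)%N ->
  exists v, v \notin U.
Proof.
move=> U0; apply: NNPP => nex.
have eU : U = fullv.
  apply/eqP; rewrite eqEsubv subvf; apply/subvP => v _.
  by apply/negPn/negP => vU; apply: nex; exists v.
by rewrite eU codim_full in U0.
Qed.

Lemma codim_idl_leq U d : (codim (idl U d) <= nmon d (codim U))%N.
Proof.
elim: d U => [|d IHd] U.
  by rewrite nmon0 /codim dimS nmon0 leq_subr.
have [m mE] : exists m, codim U = m by exists (codim U).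
elim: m U mE => [|m IHm] U mE; first by rewrite (codim_eq0 mE) idl_full codim_full.
have [L LU] : exists L, L \notin U by apply: codim_gt0P; rewrite mE.
have mE' : codim (U + <[L]>)%VS = m by have := codim_addv LU; rewrite mE => -[].
rewrite mE nmonSS (codim_hyp_colon _ L) -idl_add_line leq_add //.
  by have := IHm _ mE'; rewrite mE'.
by rewrite -mE (leq_trans (codimS (idl_sub_colon U L d))) ?IHd.
Qed.

(** The upper bound came from enlarging U up to the full space. The lower bound comes from shrinking
    U to 0, where [dimS] gives equality, with the upper bound controlling the colon at each step. *)
Lemma codim_idl U d : codim (idl U d) = nmon d (codim U).
Proof.
have [i] := ubnP (\dim U); elim: i U d => // i IHi U d.
rewrite ltnS => leU; apply/eqP; rewrite eqn_leq codim_idl_leq /=.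
case: d => [|d]; first by rewrite nmon0 /codim dimS nmon0 dimv0.
case: (posnP (\dim U)) => [/eqP|U0].
  by rewrite dimv_eq0 => /eqP ->; rewrite idl0 /codim !dimv0 !subn0 (dimS d.+1).
pose u := vpick U; pose U' := (U :\: <[u]>)%VS.
have u0 : u != 0 by rewrite vpick0 -dimv_eq0 -lt0n.
have uU : (<[u]> <= U)%VS by rewrite -memvE memv_pick.
have dimU := dimv_cap_compl U <[u]>.
rewrite (capv_idPr uU) dim_vline u0 -/U' in dimU.
have UE : (U' + <[u]>)%VS = U by rewrite addv_diff; apply/addv_idPl.
have cU' : codim U' = (codim U).+1.
  by have := dim_codim U; have := dim_codim U'; lia.
have ltU' : (\dim U' < i)%N by lia.
have := IHi U' d.+1 ltU'; rewrite cU' nmonSS (codim_hyp_colon _ u) -idl_add_line UE.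
have := leq_trans (codimS (idl_sub_colon U' u d)) (codim_idl_leq U' d).
by rewrite cU'; lia.
Qed.

(** A linear form outside U is a nonzerodivisor modulo the ideal of U: by Pascal's rule the ideal
    and its colon by L have the same codimension. *)
Lemma idl_prime (U : {vspace S 1}) L d g :
  L \notin U -> mul d L g \in idl U d.+1 -> g \in idl U d.
Proof.
move=> LU; rewrite -mem_colon.
rewrite -(codimS_eq (idl_sub_colon U L d)) //.
have := codim_hyp_colon (idl U d.+1) L; rewrite -idl_add_line !codim_idl.
by rewrite (codim_addv LU) nmonSS => /addnI ->.
Qed.

Fixpoint ups j d (V : {vspace S d}) : {vspace S (j + d)} :=
  if j is i.+1 then up (ups i V) else V.

Lemma ups_add j d (V W : {vspace S d}) : ups j (V + W) = (ups j V + ups j W)%VS.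
Proof. by elim: j => //= j ->; rewrite up_add. Qed.

Lemma ups_full j d : ups j (fullv : {vspace S d}) = fullv.
Proof. by elim: j => //= j ->; rewrite up_full. Qed.

Lemma ups_hyp j d L : (ups j (hyp L d) <= hyp L (j + d))%VS.
Proof.
elim: j => //= j IHj; exact: subv_trans (upS IHj) (up_hyp _ _).
Qed.

Lemma sub_colon_up d (V : {vspace S d}) L : (V <= colon (up V) L)%VS.
Proof. by apply/subvP => g gV; rewrite mem_colon mem_up. Qed.

Lemma general_codim_ex d (V : {vspace S d}) : exists r, general_codim V r.
Proof.
apply: generic_codim; apply: poly_sub_add; first exact: poly_sub_const.
exact: poly_sub_hyp.
Qed.

(* [U] is the space of linear forms vanishing on the ambient linear space. *)
Definition hypersurface k (U : {vspace S 1}) (F : S k.+1) : {vspace S k.+1} :=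
  (idl U k.+1 + <[F]>)%VS.

Lemma codim_hypersurface k U (F : S k.+1) : F \notin idl U k.+1 ->
  codim (hypersurface U F) = hmon 0 k (codim U).
Proof.
move=> FU; rewrite hmon0; have := codim_addv FU; rewrite codim_idl => ->.
by rewrite subn1.
Qed.

(** In the applications V contains this space and has codimension exactly [hmon], so the upper bound
    yields equality. Green's bound in degree k + 1 supplies an L outside U for which F survives
    modulo (U, L), and Pascal's rule for [hmon] does the rest. *)
Lemma codim_ups_hypersurface j k U (F : S k.+1) : F \notin idl U k.+1 ->
  (codim (ups j (hypersurface U F)) <= hmon j k (codim U))%N.
Proof.
elim: j U => [|j IHj] U FU; first by rewrite codim_hypersurface.
have [m mE] : exists m, codim U = m by exists (codim U).
elim: m U mE FU => [|m IHm] U mE FU.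
  by move: FU; rewrite (codim_eq0 mE) idl_full memvf.
case: m IHm mE => [|m] IHm mE.
  have -> : hypersurface U F = fullv.
    by apply: codim_eq0; rewrite codim_hypersurface // mE hmon1.
  by rewrite ups_full codim_full.
have cF := codim_hypersurface FU.
have [r gr] := general_codim_ex (hypersurface U F).
have := green_restriction gr; rewrite cF mE (green_hmon 0) => ler.
have [L rE] := generic_ex gr.
have n0 := nmon_gt0 k m.+1; have n1 := nmon_gt0 k.+1 m.
rewrite hmon0 in cF; rewrite hmon0 in ler.
have LU : L \notin U.
  apply/negP => /(@hyp_sub_idl _ _ k.+1) sL; move: rE.
  rewrite (addv_idPl (subv_trans sL (addvSl _ _))) cF mE nmonSS => rE.
  by move: ler; lia.
have mE' : codim (U + <[L]>)%VS = m.+1 by have := codim_addv LU; rewrite mE => -[].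
have hypE : (hypersurface U F + hyp L k.+1)%VS = hypersurface (U + <[L]>) F.
  by rewrite /hypersurface idl_add_line -!addvA (addvC (<[F]>)%VS).
have FUL : F \notin idl (U + <[L]>) k.+1.
  apply/negP; rewrite memvE => /addv_idPl sF; move: rE.
  by rewrite hypE /hypersurface sF codim_idl mE'; move: ler; lia.
rewrite hmonSS (codim_hyp_colon _ L) leq_add //.
  have := IHm _ mE' FUL; rewrite mE'; apply: leq_trans; apply: codimS.
  rewrite -hypE ups_add; apply: addvS => //; exact: (@ups_hyp j.+1 k.+1 L).
rewrite -mE; apply: leq_trans (IHj _ FU); apply: codimS; exact: sub_colon_up.
Qed.

(** * First order conditions at points of maximal rank *)

Lemma up_colon d (V : {vspace S d.+1}) L :
    max_at (fun L => V + hyp L d.+1)%VS L ->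
  (up (colon V L) <= V + hyp L d.+1)%VS.
Proof.
move=> mx; apply/up_subP => L' g; rewrite mem_colon => gV.
have pf : poly_sub (fun L => V + hyp L d.+1)%VS.
  by apply: poly_sub_add; [exact: poly_sub_const | exact: poly_sub_hyp].
apply: (max_at_limit Kinf pf mx (poly_vec_const (mul d L' g)) (y := L')) => t t0.
(* For t != 0 this puts L' g, which does not depend on t, into V + (L + t L'); the limit at t = 0 is
   the claim. *)
have -> : mul d L' g = t^-1 *: (mul d (L + t *: L') g - mul d L g).
  rewrite mul_line add_lfunE scale_lfunE addrC addKr scalerA mulVf ?scale1r //.
rewrite memvZ // memvB //; last by rewrite (subvP (addvSl _ _)).
by apply: subvP (addvSr _ _) _ _; rewrite memv_img ?memvf.
Qed.

Fixpoint mpow L a e : 'Hom(S e, S (a + e)) :=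
  if a is b.+1 then (mul (b + e) L \o mpow L b e)%VF else \1%VF.

Lemma mpow0 L e g : mpow L 0 e g = g.
Proof. exact: id_lfunE. Qed.

Lemma mpowS L a e g : mpow L a.+1 e g = mul (a + e) L (mpow L a e g).
Proof. exact: comp_lfunE. Qed.

Lemma limg_mpow0 L e : limg (mpow L 0 e) = fullv.
Proof. exact: lim1g. Qed.

Lemma limg_mpowS L a e : limg (mpow L a.+1 e) = (mul (a + e) L @: limg (mpow L a e))%VS.
Proof. exact: limg_comp. Qed.

Arguments mpow : simpl never.

Lemma poly_sub_mpow a e : poly_sub (fun L => limg (mpow L a e)).
Proof.
elim: a => [|a IHa] x y; first exact: (poly_space_const (limg \1%VF)).
have [r [P fP]] := poly_sub_limg (mul_line (a + e)) IHa x y.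
by exists r, P => t; rewrite limg_mpowS; apply: fP.
Qed.

Lemma mpow_line a e (g : S e) L L' : exists w : K -> S (a.+1 + e),
  [/\ poly_vec w,
      forall t, mpow (L + t *: L') a.+1 e g = mpow L a.+1 e g + t *: w t
    & w 0 = a.+1%:R *: mul _ L' (mpow L a e g)].
Proof.
elim: a => [|a [w [pw wE w0]]].
  exists (fun=> mul e L' g); split=> [|t|]; first exact: poly_vec_const.
    by rewrite !mpowS !mpow0 mul_line add_lfunE scale_lfunE.
  by rewrite scale1r mpow0.
exists (fun t => (mul _ L + t *: mul _ L') (w t) + mul _ L' (mpow L a.+1 e g)).
split=> [|t|]; first by apply: poly_vecD (poly_vec_const _); apply: poly_vec_lfun.
  rewrite mpowS wE mul_line !add_lfunE !scale_lfunE !linearD !linearZ /=.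
  rewrite [in RHS]mpowS -!addrA; congr (_ + _).
  by congr (_ + _); rewrite addrC.
rewrite scale0r addr0 w0 linearZ /= mulC -mpowS.
by rewrite -[a.+2%:R]natr1 scalerDl scale1r.
Qed.

(** The limit now is of the difference quotient of L^(a+1) g in the direction L'. Its value at t = 0
    is (a + 1) L' L^a g, and characteristic 0 allows division by a + 1. *)
Lemma mpow_limit a e (V : {vspace S (a.+1 + e)}) L L' (g : S e) :
    max_at (fun L => V + limg (mpow L a.+1 e))%VS L ->
    mpow L a.+1 e g \in V ->
  mul _ L' (mpow L a e g) \in (V + limg (mpow L a.+1 e))%VS.
Proof.
move=> mx gV; have [w [pw wE w0]] := mpow_line a g L L'.
have a0 : a.+1%:R != 0 :> K by rewrite (pcharf0P _).1.
have pf : poly_sub (fun L => V + limg (mpow L a.+1 e))%VS.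
  by apply: poly_sub_add; [exact: poly_sub_const | exact: poly_sub_mpow].
have := max_at_limit Kinf pf mx pw (y := L') _; rewrite w0 => h.
rewrite -[X in X \in _]scale1r -(mulVf a0) -scalerA memvZ //; apply: h => t t0.
have -> : w t = t^-1 *: (mpow (L + t *: L') a.+1 e g - mpow L a.+1 e g).
  by rewrite wE addrC addKr scalerA mulVf ?scale1r.
rewrite memvZ // memvB //; last by rewrite (subvP (addvSl _ _)).
by apply: subvP (addvSr _ _) _ _; rewrite memv_img ?memvf.
Qed.
(** If L^2 were in V, the first order condition would put every L L' into V + (L^2) = V, and V : L
    would be everything. *)
Lemma square_notin_colon (V : {vspace S 2}) L :
    max_at (fun L => V + limg (mpow L 2 0))%VS L -> (0 < codim (colon V L))%N ->
  L \notin colon V L.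
Proof.
move=> mx cV; apply/negP; rewrite mem_colon => LV.
have m1 L' : mpow L' 1 0 one = L' by rewrite mpowS mpow0 mul_one.
have m2 : mpow L 2 0 one \in V by rewrite mpowS m1.
have sV : (V + limg (mpow L 2 0) <= V)%VS.
  rewrite subv_add subvv; apply/subvP => _ /memv_imgP[g _ ->].
  by have [a ->] := S0_line g; rewrite linearZ memvZ.
move: cV; rewrite (_ : colon V L = fullv) ?codim_full //.
apply: codimS_eq; rewrite ?subvf // codimS //; apply/subvP => L' _.
rewrite mem_colon; have := subvP sV _ (@mpow_limit 1 0 V L L' one mx m2).
by rewrite m1 -{1}(mul_one L) mulC mul_one.
Qed.

(* If [V : L'] and [V : L] differ, both [(V, L) : L'] and [(V, L') : L] are
   their sum, so [L'] lies in [(V, L) : L'], i.e. [L'^2] in [(V, L)]. *)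
Lemma quadric_colon_const (V : {vspace S 2}) r a b :
    generic (fun p : S 1 * S 1 =>
      pair_codims V r a b p.1 p.2 /\ pair_codims V r a b p.2 p.1) ->
    (codim V - r = b.+1)%N -> (r - a = b)%N -> (0 < b)%N ->
  generic (fun p : S 1 * S 1 => colon V p.1 = colon V p.2).
Proof.
move=> g cb ab b0.
have gm1 : generic (max_at (fun L => V + hyp L 2)%VS).
  apply: (generic_max (f := fun L => V + hyp L 2)%VS).
  by apply: poly_sub_add; [exact: poly_sub_const | exact: poly_sub_hyp].
have gm2 : generic (max_at (fun L => V + limg (mpow L 2 0))%VS).
  apply: (generic_max (f := fun L => V + limg (mpow L 2 0))%VS).
  by apply: poly_sub_add; [exact: poly_sub_const | exact: (poly_sub_mpow 2 0)].
have gm3 : generic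
    (max_at (fun p : S 1 * S 1 => V + hyp p.1 2 + limg (mpow p.2 2 0))%VS).
  apply: (generic_max (f := fun p => V + hyp p.1 2 + limg (mpow p.2 2 0))%VS).
  apply: poly_sub_add; last by move=> x y; exact: (poly_sub_mpow 2 0 x.2 y.2).
  by apply: poly_sub_add; [exact: poly_sub_const | exact: poly_sub_hyp].
have key L L' : pair_codims V r a b L L' -> pair_codims V r a b L' L ->
    max_at (fun L => V + hyp L 2)%VS L ->
    max_at (fun L => V + limg (mpow L 2 0))%VS L ->
    max_at (fun p : S 1 * S 1 => V + hyp p.1 2 + limg (mpow p.2 2 0))%VS (L, L') ->
  [/\ codim (colon V L) = b.+1,
    colon (V + hyp L 2)%VS L' = (colon V L + <[L]>)%VS,
    (colon V L' <= colon (V + hyp L 2)%VS L')%VS,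
    codim (colon (V + hyp L 2)%VS L') = b
    & L' \notin colon (V + hyp L 2)%VS L'].
  move=> [rE aE _] [_ _ bE] mx1 mx2 mx3.
  have cL : codim (colon V L) = b.+1 by have := codim_hyp_colon V L; lia.
  have cLL' : codim (colon (V + hyp L 2)%VS L') = b.
    by have := codim_hyp_colon (V + hyp L 2)%VS L'; rewrite rE aE; lia.
  have LV : L \notin colon V L by apply: square_notin_colon; rewrite ?cL.
  split=> //; last 2 first.
  - exact: subv_trans (addvSl _ _) (hyp_sub_colon V L L').
  (* Maximality at the pair (L, L') implies maximality in the second entry with L fixed, that is,
     for V + (L). *)
  - apply: square_notin_colon; rewrite ?cLL' // => L''; exact: (mx3 (L, L'')).
  apply/esym/codimS_eq; last by have := codim_addv LV; rewrite cL cLL' => -[<-].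
  rewrite subv_add; apply/andP; split.
    apply/subvP => u uV; rewrite mem_colon.
    exact: subvP (up_colon mx1) _ (mem_up _ uV).
  rewrite -memvE; apply: subvP (hyp_sub_colon V L L') _ _.
  by apply: subvP (addvSr _ _) _ _; rewrite -{1}(mul_one L) memv_img ?memvf.
have := generic_and Kinf (generic_and Kinf g (generic_diag Kinf gm1 gm1))
  (generic_and Kinf (generic_diag Kinf gm2 gm2)
     (generic_and Kinf gm3 (generic_swap gm3))).
apply: generic_mono => -[L L'] /= [[[p1 p2] [m1 m1']] [[m2 m2'] [m3 m3']]].
have [cU eQ sU' cQ nL'] := key L L' p1 p2 m1 m2 m3.
have [cU' eQ' sU cQ' _] := key L' L p2 p1 m1' m2' m3'.
apply: NNPP => neq.
have lt : (codim (colon V L + colon V L') <= b)%N.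
  rewrite -ltnS -cU ltn_neqAle codimS ?addvSl // andbT; apply/negP => /eqP e.
  have e1 := codimS_eq (addvSl (colon V L) (colon V L')) (eq_leq (esym e)).
  apply: neq; apply/esym; apply: codimS_eq; rewrite ?cU ?cU' //.
  by rewrite e1 addvSr.
have eS : (colon V L + colon V L')%VS = colon (V + hyp L 2)%VS L'.
  by apply: codimS_eq; rewrite ?cQ // subv_add sU' eQ addvSl.
have eS' : (colon V L + colon V L')%VS = colon (V + hyp L' 2)%VS L.
  by apply: codimS_eq; rewrite ?cQ' // subv_add sU eQ' addvSl.
by move: nL'; rewrite -eS eS' eQ' memvE addvSr.
Qed.

(** * The extremal case for linear spaces *)

Lemma const_colon d (V : {vspace S d.+1}) (P : S 1 -> Prop) : generic P ->
    generic (fun p : S 1 * S 1 => colon V p.1 = colon V p.2) ->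
  exists2 L, P L & (up (colon V L) <= V)%VS.
Proof.
move=> gP /generic_slices gc.
have [L [PL gL]] := generic_ex (generic_and Kinf gP gc).
(* With L fixed and L' varying, L' (V : L) = L' (V : L') lies in V. *)
exists L => //; apply: generic_up; apply: generic_mono gL => L' /= <-.
by apply/subvP => _ /memv_imgP[g gV ->]; rewrite -mem_colon.
Qed.

Lemma colonC d (V : {vspace S d.+2}) L L' : colon (colon V L) L' = colon (colon V L') L.
Proof. by apply/vspaceP => g; rewrite !mem_colon mulC. Qed.

(** Codimension [m.+2] rather than [m.+1]: when [nmon d 1] = 1 is the codimension, the restriction
    is 0 for every such V in positive degree, linear or not. *)
Definition linear_in_degree d : Prop := forall (V : {vspace S d}) m,
    codim V = nmon d m.+2 -> general_codim V (nmon d m.+1) ->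
  exists2 U, codim U = m.+2 & V = idl U d.

(** Serves linear spaces and also hypersurfaces in the degree of their equation. In both cases V : L
    has the numbers of a linear space, whereas V itself may be larger than the ideal found. *)
Lemma linear_colon d (V : {vspace S d.+2}) r a m : linear_in_degree d.+1 ->
    generic (fun p : S 1 * S 1 =>
      pair_codims V r a (nmon d.+1 m.+1) p.1 p.2 /\
      pair_codims V r a (nmon d.+1 m.+1) p.2 p.1) ->
    (codim V - r = nmon d.+1 m.+2)%N -> (r - a = nmon d.+1 m.+1)%N ->
  exists2 U, codim U = m.+2 & (idl U d.+2 <= V)%VS.
Proof.
move=> lin g cb ab; have gp := pair_codims_general g.
have gU : generic (fun L => exists2 U, codim U = m.+2 & colon V L = idl U d.+1).
  apply: generic_mono gp => L [rE _ gL]; apply: lin gL.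
  by have := codim_hyp_colon V L; lia.
suff gc : generic (fun p : S 1 * S 1 => colon V p.1 = colon V p.2).
  have [L [U cU ->]] := const_colon gU gc; rewrite up_idl => sV.
  by exists U.
(* In degree 2 the double colon lies in degree 0 and says nothing about U, so the argument for
   quadrics takes over. In higher degree it is the ideal of U one degree below V : L, which
   determines V : L. *)
case: d V lin g cb ab gp gU => [|d] V lin g cb ab gp gU.
  by apply: quadric_colon_const g _ ab _; rewrite ?cb !nmon1.
apply: generic_mono (generic_and Kinf g (generic_diag Kinf gU gU)).
move=> [L L'] /= [[[r1 _ b1] [r2 _ b2]] [[U cU eU] [U' cU' eU']]].
have key M M' W : codim (V + hyp M d.+3)%VS = r ->
    codim (colon V M + hyp M' d.+2)%VS = nmon d.+2 m.+1 ->
    codim W = m.+2 -> colon V M = idl W d.+2 ->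
  colon (colon V M) M' = idl W d.+1.
  move=> rE bE cW eW; apply/esym/codimS_eq; first by rewrite eW idl_sub_colon.
  have := codim_hyp_colon V M; have := codim_hyp_colon (colon V M) M'.
  by rewrite rE bE codim_idl cW; have := nmonSS d.+1 m.+1; lia.
have := colonC V L L'; rewrite (key L L' U) // (key L' L U') // => eI.
by rewrite eU eU' -!up_idl eI.
Qed.

Lemma linear_extremal d : linear_in_degree d.+1.
Proof.
elim: d => [|d IHd] V m cV gV; first by exists V; rewrite ?idl1 // cV nmon1.
have g := @generic_extremal _ V _ (nmon d.+2 m) (nmon d.+1 m.+1) gV.
have cb : (codim V - nmon d.+2 m.+1 = nmon d.+1 m.+2)%N by rewrite cV nmonSS addKn.
have ab : (nmon d.+2 m.+1 - nmon d.+2 m = nmon d.+1 m.+1)%N by rewrite nmonSS addKn.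
rewrite cb !green_nmon in g.
have [U cU sU] := linear_colon IHd (g erefl erefl (nmonSS _ _)) cb ab.
by exists U => //; apply/esym/codimS_eq; rewrite ?codim_idl ?cU ?cV.
Qed.

(* [L^a S_(d-a)], and [0] when [a > d]. *)
Fixpoint pow_space L a d : {vspace S d} :=
  if a is b.+1 then
    if d is e.+1 then (mul e L @: pow_space L b e)%VS else 0%VS
  else fullv.

Lemma pow_spaceE L a e : pow_space L a (a + e) = limg (mpow L a e).
Proof.
elim: a => [|a IHa]; first by rewrite limg_mpow0.
by rewrite /= IHa limg_mpowS.
Qed.

Lemma poly_sub_pow_space a d : poly_sub (fun L => pow_space L a d).
Proof.
elim: a d => [|a IHa] d /=; first exact: poly_sub_const.
case: d => [|d]; first exact: poly_sub_const.
by apply: poly_sub_limg (IHa d); apply: mul_line.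
Qed.

Lemma mpow_pow_space L a e b g :
  g \in pow_space L b e -> mpow L a e g \in pow_space L (a + b) (a + e).
Proof.
elim: a => [|a IHa] gb /=; first by rewrite mpow0.
by rewrite mpowS memv_img ?IHa.
Qed.

Arguments pow_space : simpl never.

Lemma mpow_idl U L a e g : g \in idl U e -> mpow L a e g \in idl U (a + e).
Proof.
elim: a => [|a IHa] gU /=; first by rewrite mpow0.
by rewrite mpowS; apply: subvP (up_idl_sub _ _) _ (mem_up _ (IHa gU)).
Qed.

Lemma mpow_cancel (U : {vspace S 1}) L L' a e (g s : S e) : L \notin U ->
    mul _ L' (mpow L a e g) - mul _ L (mpow L a e s) \in idl U (a + e).+1 ->
  mul _ L' g - mul _ L s \in idl U e.+1.
Proof.
move=> LU; elim: a => [|a IHa]; first by rewrite !mpow0.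
rewrite !mpowS mulC -linearB => /(idl_prime LU); exact: IHa.
Qed.

(** Write F = u + L^(a+1) g modulo U. Then L^(a+2) g is in V, and the first order condition gives L'
    L^a g = L^(a+1) s modulo V : L = (U, F), hence modulo U after changing s by a multiple of g.
    Cancelling L^a shows that L' g, and so g, lies in (U, L). If e = 0 this means g = 0 and F lies
    in (U), a contradiction; otherwise g gives one more factor L. *)
Lemma hypersurface_pow_step a e k (V : {vspace S k.+2}) (U : {vspace S 1})
    (F : S k.+1) L :
    k = (a + e)%N -> L \notin U -> (1 < codim U)%N ->
    colon V L = hypersurface U F -> F \notin idl U k.+1 ->
    max_at (fun L => V + pow_space L a.+2 k.+2)%VS L ->
    F \in (idl U k.+1 + pow_space L a.+1 k.+1)%VS ->
  (0 < e)%N /\ F \in (idl U k.+1 + pow_space L a.+2 k.+1)%VS.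
Proof.
move=> kE; subst k => LU cU eV FU mx.
rewrite -[pow_space L a.+1 _]/(pow_space L a.+1 (a.+1 + e)) pow_spaceE.
case/memv_addP => u uU [_ /memv_imgP[g _ ->] FE].
have mx' : max_at (fun L => V + limg (mpow L a.+2 e))%VS L.
  by move=> x'; rewrite -!pow_spaceE; apply: mx.
have gV : mpow L a.+2 e g \in V.
  rewrite mpowS -mem_colon eV.
  have -> : mpow L a.+1 e g = F - u by rewrite FE addrC addKr.
  rewrite memvB // /hypersurface; first by rewrite memvE addvSr.
  exact: subvP (addvSl _ _) _ uU.
have gU L' : L' \notin (U + <[L]>)%VS -> g \in idl (U + <[L]>) e.
  move=> L'U; apply: (idl_prime L'U).
  have /memv_addP[v vV [_ /memv_imgP[s _ ->] vE]] := @mpow_limit a.+1 e V L L' g mx' gV.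
  have : mul _ L' (mpow L a e g) - mpow L a.+1 e s \in colon V L.
    by rewrite mem_colon linearB /= mulC -mpowS vE (mpowS L a.+1) addrK.
  rewrite eV => /memv_addP[i iU [_ /vlineP[c ->] iE]].
  have : mul _ L' (mpow L a e g) - mul _ L (mpow L a e (s + c *: g))
      \in idl U (a + e).+1.
    have -> : mul _ L (mpow L a e (s + c *: g)) = mpow L a.+1 e s + c *: (F - u).
      by rewrite FE [u + _]addrC addrK -mpowS linearD linearZ.
    by rewrite opprD addrA iE scalerBr opprB addrA addrAC addrK memvD ?memvZ.
  move/(mpow_cancel LU) => h; rewrite idl_add_line.
  rewrite -(subrK (mul e L (s + c *: g)) (mul e L' g)) memv_add //.
  by rewrite memv_img ?memvf.
have {gU} gU : g \in idl (U + <[L]>) e.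
  have [L' /gU//] : exists L', L' \notin (U + <[L]>)%VS.
  by apply: codim_gt0P; move: cU; rewrite (codim_addv LU).
clear V eV mx mx' gV; case: e F FU u uU g FE gU => [|e] F FU u uU g FE gU.
  move: gU; rewrite memv0 => /eqP g0; move: FU.
  by rewrite FE g0 linear0 addr0 uU.
split=> //; move: gU; rewrite idl_add_line FE.
case/memv_addP=> u' u'U [_ /memv_imgP[g' _ ->] ->].
rewrite linearD addrA memv_add //.
  by rewrite memvD //; apply: (@mpow_idl _ _ a.+1).
have := @mpow_pow_space L a.+1 e.+1 1 (mul e L g').
by rewrite addn1 => -> //=; rewrite memv_img ?memvf.
Qed.

(* A form [F_L] with [V : L = (U, F_L)] divisible by [L] modulo [U] would be
   divisible by every power of [L], by differentiating [L^a G] along [L]. *)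
Lemma hypersurface_not_div k (V : {vspace S k.+2}) (U : {vspace S 1}) (F : S k.+1) L :
    L \notin U -> (1 < codim U)%N ->
    colon V L = hypersurface U F -> F \notin idl U k.+1 ->
    (forall a, (a <= k)%N -> max_at (fun L => V + pow_space L a.+2 k.+2)%VS L) ->
  F \notin idl (U + <[L]>) k.+1.
Proof.
move=> LU cU eV FU mx; apply/negP; rewrite idl_add_line => FL.
suff h e : (e <= k)%N ->
    F \in (idl U k.+1 + pow_space L (k - e).+1 k.+1)%VS -> False.
  by apply: (h k); rewrite ?subnn.
(* The induction runs towards higher powers: the exponent is k - e + 1, and at e = 0 the step lemma
   returns the absurd 0 < 0. *)
elim: e => [|e IHe] lek {}FL.
  have kE : k = (k - 0 + 0)%N by lia.
  by have [//] := hypersurface_pow_step kE LU cU eV FU (mx _ (leq_subr _ _)) FL.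
have kE : k = (k - e.+1 + e.+1)%N by lia.
have [_] := hypersurface_pow_step kE LU cU eV FU (mx _ (leq_subr _ _)) FL.
by rewrite subnSK //; apply: IHe; apply: ltnW.
Qed.

(** * The extremal case for hypersurfaces *)

Lemma ups_idl U j k : ups j (idl U k.+1) = idl U (j + k.+1).
Proof.
have up_idl_gt0 e : (0 < e)%N -> up (idl U e) = idl U e.+1.
  by case: e => // e _; apply: up_idl.
by elim: j => [//|j IHj] /=; rewrite IHj up_idl_gt0 // addnS.
Qed.

(** The bound [m.+3] corresponds to c > 0. On a line a hypersurface is k + 1 points, and
    [hmon j k 1] = 0 is the general restriction of every V of codimension k + 1, so the numbers
    carry no information. *)
Definition hypersurface_in_degree j k : Prop :=
  forall (V : {vspace S (j + k.+1)}) m,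
    codim V = hmon j k m.+3 -> general_codim V (hmon j k m.+2) ->
  exists U (F : S k.+1),
    [/\ codim U = m.+3, F \notin idl U k.+1 & V = ups j (hypersurface U F)].

(** Here V : L has the numbers of a linear space. The resulting ideal of U has codimension one more
    than V, so any form of V outside it serves as F. The degree is k + 2 since a linear F is covered
    by [linear_extremal]. *)
Lemma hypersurface_deg0 k : hypersurface_in_degree 0 k.+1.
Proof.
move=> V m; rewrite !hmon0 => cV gV.
have n1 := nmon_gt0 k.+2 m; have n2 := nmon_gt0 k.+1 m.+1.
have n3 := nmon_gt0 k.+1 m.+2.
have s1 := nmonSS k.+1 m.+2; have s2 := nmonSS k.+1 m.+1.
have cb : (codim V - (nmon k.+2 m.+2 - 1) = nmon k.+1 m.+3)%N by lia.
have ab : (nmon k.+2 m.+2 - 1 - (nmon k.+2 m.+1 - 1) = nmon k.+1 m.+2)%N by lia.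
have g := @generic_extremal k V _ (nmon k.+2 m.+1 - 1) (nmon k.+1 m.+2) gV.
have gh := green_hmon 0 k.+1 m; rewrite !hmon0 in gh.
rewrite cb green_nmon gh in g.
have [|U cU sU] := linear_colon (@linear_extremal k) (g erefl erefl _) cb ab.
  by lia.
have /subvPn[F FV FU] : ~~ (V <= idl U k.+2)%VS.
  apply/negP => /codimS; rewrite codim_idl cU cV add0n; lia.
exists U, F; split=> //; apply/esym/codimS_eq.
  by rewrite subv_add sU -memvE.
by rewrite codim_hypersurface // cU hmon0 cV.
Qed.

Lemma hypersurface_step j k :
  hypersurface_in_degree j.+1 k -> hypersurface_in_degree j.+2 k.
Proof.
pose e := (j + k.+1)%N; rewrite /hypersurface_in_degree => IH'.
have IH : forall (V : {vspace S e.+1}) m,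
    codim V = hmon j.+1 k m.+3 -> general_codim V (hmon j.+1 k m.+2) ->
    exists U (F : S k.+1),
      [/\ codim U = m.+3, F \notin idl U k.+1 & V = ups j.+1 (hypersurface U F)].
  exact: IH'.
(* The two degrees are convertible; this form exposes the successors that [colon] and
   [generic_extremal] expect. *)
change (forall (V : {vspace S e.+2}) m,
  codim V = hmon j.+2 k m.+3 -> general_codim V (hmon j.+2 k m.+2) ->
  exists U (F : S k.+1),
    [/\ codim U = m.+3, F \notin idl U k.+1 & V = ups j.+2 (hypersurface U F)]).
move=> {IH'} V m cV gV.
have cb : (codim V - hmon j.+2 k m.+2 = hmon j.+1 k m.+3)%N.
  by rewrite cV hmonSS addKn.
have g := generic_extremal (a := hmon j.+2 k m.+1) (b := hmon j.+1 k m.+2) gV.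
rewrite cb (green_hmon j.+2 k m) (green_hmon j.+1 k m.+1) in g.
have {}g := g erefl erefl (hmonSS _ _ _); have gp := pair_codims_general g.
have gU : generic (fun L => exists U (F : S k.+1), [/\ codim U = m.+3,
    F \notin idl U k.+1 & colon V L = ups j.+1 (hypersurface U F)]).
  apply: generic_mono gp => L [rE _ gL]; apply: IH gL.
  by have := codim_hyp_colon V L; lia.
have [L [U [F [cU FU eV]]] sV] : exists2 L, exists U (F : S k.+1),
    [/\ codim U = m.+3, F \notin idl U k.+1 & colon V L = ups j.+1 (hypersurface U F)]
    & (up (colon V L) <= V)%VS; last first.
  exists U, F; split=> //; apply/esym/codimS_eq; first by rewrite eV in sV.
  by rewrite cV -cU; apply: (codim_ups_hypersurface j.+2 FU).
apply: (const_colon gU).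
apply: generic_mono (generic_and Kinf g (generic_diag Kinf gU gU)).
move=> [L L'] /= [[[r1 _ b1] [r2 _ b2]] []].
move=> [U [F [cU FU eU]]] [U' [F' [cU' FU' eU']]].
(* The double colon still has degree at least that of F, so it contains the equation and determines
   V : L by one multiplication. *)
have key M M' W (G : S k.+1) : codim (V + hyp M e.+2)%VS = hmon j.+2 k m.+2 ->
    codim (colon V M + hyp M' e.+1)%VS = hmon j.+1 k m.+2 ->
    codim W = m.+3 -> G \notin idl W k.+1 ->
    colon V M = ups j.+1 (hypersurface W G) ->
  colon (colon V M) M' = ups j (hypersurface W G).
  move=> rE bE cW GW eW; apply/esym/codimS_eq; first by rewrite eW sub_colon_up.
  apply: leq_trans (codim_ups_hypersurface j GW) _; rewrite cW.
  have := codim_hyp_colon V M.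
  have := codim_hyp_colon (colon V M) M'.
  by rewrite rE bE; have := hmonSS j k m.+1; lia.
have := colonC V L L'; rewrite (key L L' U F) // (key L' L U' F') // => eI.
by rewrite eU eU' /= eI.
Qed.
(** Otherwise F and G span a pencil modulo U, and Green's bound keeps it two-dimensional on a
    general hyperplane, whereas the hypothesis leaves room for one form. *)
Lemma general_pencil k U (F G : S k.+2) m : codim U = m.+3 ->
    F \notin idl U k.+2 ->
    generic (fun L => (nmon k.+2 m.+2 - 1 <=
      codim (hypersurface U F + <[G]> + hyp L k.+2)%VS)%N) ->
  G \in hypersurface U F.
Proof.
move=> cU FU gL; apply/negPn/negP => GF.
have [r gr] := general_codim_ex (hypersurface U F + <[G]>)%VS.
have [L [le rE]] := generic_ex (generic_and Kinf gL gr).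
have := green_restriction gr; have := codim_addv GF.
rewrite codim_hypersurface // cU hmon0 => cP.
have -> : codim (hypersurface U F + <[G]>)%VS = (nmon k.+2 m.+3 - 2)%N by lia.
have := nmon_ge k.+1 m.+2.
by rewrite green_nmon_sub2; lia.
Qed.

Lemma hypersurface_deg1 k : hypersurface_in_degree 1 k.+1.
Proof.
have IH : forall (V : {vspace S k.+2}) m,
    codim V = hmon 0 k.+1 m.+3 -> general_codim V (hmon 0 k.+1 m.+2) ->
    exists U (F : S k.+2),
      [/\ codim U = m.+3, F \notin idl U k.+2 & V = hypersurface U F].
  exact: hypersurface_deg0.
change (forall (V : {vspace S k.+3}) m,
  codim V = hmon 1 k.+1 m.+3 -> general_codim V (hmon 1 k.+1 m.+2) ->
  exists U (F : S k.+2),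
    [/\ codim U = m.+3, F \notin idl U k.+2 & V = ups 1 (hypersurface U F)]).
move=> V m cV gV.
have cb : (codim V - hmon 1 k.+1 m.+2 = hmon 0 k.+1 m.+3)%N.
  by rewrite cV hmonSS addKn.
have g := generic_extremal (a := hmon 1 k.+1 m.+1) (b := hmon 0 k.+1 m.+2) gV.
rewrite cb (green_hmon 1 k.+1 m) (green_hmon 0 k.+1 m.+1) in g.
have {}g := g erefl erefl (hmonSS _ _ _); have gp := pair_codims_general g.
have cC L : codim (V + hyp L k.+3)%VS = hmon 1 k.+1 m.+2 ->
    codim (colon V L) = hmon 0 k.+1 m.+3.
  by have := codim_hyp_colon V L; lia.
have gUL : generic (fun L => exists U (F : S k.+2), [/\ codim U = m.+3,
    F \notin idl U k.+2 & colon V L = hypersurface U F]).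
  by apply: generic_mono gp => L [rE _ gL]; apply: IH gL; apply: cC.
(* The double colon is now one degree below the equation: it shows that U is the same for all
   general L, but F may still depend on L. *)
have [U cU gU] : exists2 U, codim U = m.+3 & generic (fun L => exists2 F : S k.+2,
    F \notin idl U k.+2 & colon V L = hypersurface U F).
  have := generic_slices (generic_and Kinf g (generic_diag Kinf gUL gUL)).
  move/generic_ex => [L1 gs]; have [_ /= [_ [_ [U [F [cU FU eU]]]]]] := generic_ex gs.
  exists U => //; apply: generic_mono gs => L /= [[[r1 _ b1] [r2 _ b2]]].
  move=> [[U' [F' [cU' FU' eU']]] _].
  have key M M' W (H : S k.+2) : codim (V + hyp M k.+3)%VS = hmon 1 k.+1 m.+2 ->
      codim (colon V M + hyp M' k.+2)%VS = hmon 0 k.+1 m.+2 ->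
      codim W = m.+3 -> colon V M = hypersurface W H ->
    colon (colon V M) M' = idl W k.+1.
    move=> rE bE cW eW; apply/esym/codimS_eq.
      rewrite eW (subv_trans (idl_sub_colon W M' k.+1)) //.
      by apply: lpreimS; apply: addvSl.
    have := codim_hyp_colon (colon V M) M'; rewrite bE (cC _ rE) codim_idl cW !hmon0.
    by have := nmonSS k.+1 m.+2; have := nmon_gt0 k.+2 m.+1; lia.
  have := colonC V L L1; rewrite (key L L1 U' F') // (key L1 L U F) // => eI.
  have eI' : idl U' k.+2 = idl U k.+2 by rewrite -!up_idl eI.
  by exists F'; rewrite -?eI' // eU' /hypersurface eI'.
have sUV : (idl U k.+3 <= V)%VS.
  rewrite -up_idl; apply: generic_up; apply: generic_mono gU => L [F _ eF].
  apply/subvP => _ /memv_imgP[f fU ->]; rewrite -mem_colon eF.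
  exact: subvP (addvSl _ _) _ fU.
have gmx : generic (fun L => forall a, (a <= k.+1)%N ->
    max_at (fun L => V + pow_space L a.+2 k.+3)%VS L).
  have gm a : generic (max_at (fun L => V + pow_space L a.+2 k.+3)%VS).
    apply: (generic_max (f := fun L => V + pow_space L a.+2 k.+3)%VS).
    by apply: poly_sub_add; [exact: poly_sub_const | exact: poly_sub_pow_space].
  suff gi i : generic (fun L => forall a, (a <= i)%N ->
    max_at (fun L => V + pow_space L a.+2 k.+3)%VS L) by exact: gi.
  elim: i => [|i IHi].
    by apply: generic_mono (gm 0%N) => L mx a; rewrite leqn0 => /eqP ->.
  apply: generic_mono (generic_and Kinf IHi (gm i.+1)) => L [mx1 mx2] a.
  by rewrite leq_eqVlt => /orP[/eqP -> | /mx1].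
have gmx1 : generic (max_at (fun L => V + hyp L k.+3)%VS).
  apply: (generic_max (f := fun L => V + hyp L k.+3)%VS).
  by apply: poly_sub_add; [exact: poly_sub_const | exact: poly_sub_hyp].
(* Since F is nonzero modulo (U, L), the ideal (U, L, F) has the codimension of V_L : L'. It is
   contained in it by [up_colon], hence equal to it, and V_L : L' contains V : L'. *)
have gQ : generic (fun p : S 1 * S 1 =>
    codim (colon V p.1 + hyp p.1 k.+2)%VS = (nmon k.+2 m.+2 - 1)%N /\
    (colon V p.2 <= colon V p.1 + hyp p.1 k.+2)%VS).
  apply: generic_mono (generic_and Kinf (generic_and Kinf g (generic_fst _ gU))
     (generic_fst _ (generic_and Kinf gmx gmx1))).
  move=> [L L'] /= [[[[rE aE _] [_ _ _]] [F FU eF]] [mx mx1]].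
  have LU : L \notin U.
    apply/negP => /(@hyp_sub_idl _ _ k.+3) sL; move: rE.
    rewrite (addv_idPl (subv_trans sL sUV)) cV hmonSS.
    have := nmonSS k.+1 m.+2; have := nmon_gt0 k.+2 m.+1.
    by have := nmon_gt0 k.+1 m.+2; rewrite hmon0; lia.
  have cUL : codim (U + <[L]>)%VS = m.+2 by have := codim_addv LU; rewrite cU => -[].
  have cU1 : (1 < codim U)%N by rewrite cU.
  have FUL := hypersurface_not_div LU cU1 eF FU mx.
  have hE : (colon V L + hyp L k.+2)%VS = hypersurface (U + <[L]>) F.
    by rewrite eF /hypersurface idl_add_line -!addvA (addvC (<[F]>)%VS).
  have cH : codim (hypersurface (U + <[L]>) F) = (nmon k.+2 m.+2 - 1)%N.
    by rewrite codim_hypersurface // cUL hmon0.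
  rewrite hE cH; split=> //.
  have -> : hypersurface (U + <[L]>) F = colon (V + hyp L k.+3)%VS L'.
    apply: codimS_eq.
      rewrite subv_add; apply/andP; split.
        apply: subv_trans (idl_sub_colon _ L' _) _; apply: lpreimS.
        by rewrite idl_add_line addvS.
      rewrite -memvE mem_colon; apply: subvP (up_colon mx1) _ _; apply: mem_up.
      by rewrite eF memvE addvSr.
    have := codim_hyp_colon (V + hyp L k.+3)%VS L'.
    by rewrite rE aE cH hmonSS hmon0; lia.
  exact: subv_trans (addvSl _ _) (hyp_sub_colon V L L').
have gs := generic_and Kinf gU (generic_slices gQ).
(* For a third general form x, both V : L1 and V : L2 lie in (V : x) + (x), which is a hypersurface
   on x = 0; the pencil of F1 and F2 would degenerate there. *)
have key L1 L2 F1 F2 : F1 \notin idl U k.+2 -> F2 \notin idl U k.+2 ->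
    colon V L1 = hypersurface U F1 -> colon V L2 = hypersurface U F2 ->
    generic (fun x => codim (colon V x + hyp x k.+2)%VS = (nmon k.+2 m.+2 - 1)%N /\
      (colon V L1 <= colon V x + hyp x k.+2)%VS) ->
    generic (fun x => codim (colon V x + hyp x k.+2)%VS = (nmon k.+2 m.+2 - 1)%N /\
      (colon V L2 <= colon V x + hyp x k.+2)%VS) ->
  (colon V L2 <= colon V L1)%VS.
  move=> FU1 FU2 e1 e2 g1 g2.
  rewrite e1 e2 subv_add addvSl -memvE /=; apply: general_pencil cU FU1 _.
  apply: generic_mono (generic_and Kinf g1 g2) => x [[<- s1] [_ s2]].
  apply: codimS; rewrite subv_add addvSr andbT subv_add -e1 s1 /=.
  by apply: subv_trans s2; rewrite e2 addvSr.
have gc : generic (fun p : S 1 * S 1 => colon V p.1 = colon V p.2).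
  apply: generic_mono (generic_diag Kinf gs gs) => -[L1 L2] /=.
  move=> [[[F1 FU1 e1] g1] [[F2 FU2 e2] g2]].
  by apply: subv_anti; rewrite (key L1 L2 F1 F2) // (key L2 L1 F2 F1).
have [L [F FU eF] sV] := const_colon gU gc.
exists U, F; split=> //; apply/esym/codimS_eq; first by rewrite eF in sV.
by rewrite cV -cU; apply: (codim_ups_hypersurface 1 FU).
Qed.

Theorem extremal_hypersurface j k (V : {vspace S (j + k.+1)}) m :
    (m.+3 <= \dim {:S 1})%N ->
    codim V = hmon j k m.+3 -> general_codim V (hmon j k m.+2) ->
  exists U (F : S k.+1),
    [/\ codim U = m.+3, F \notin idl U k.+1 & V = ups j (hypersurface U F)].
Proof.
case: k V => [|k] V lem.
  rewrite !hmonj0 => cV gV.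
  have [U cU eV] : exists2 U, codim U = m.+2 & V = idl U (j + 1).
    move: (j + 1)%N (addn1 j) V cV gV => d -> V; exact: linear_extremal.
  (* A hypersurface of degree 1 is a linear space: split one linear form F off U. The bound [lem]
     ensures that U is nonzero. *)
  have U0 : U != 0%VS.
    by apply/eqP => U0; move: cU; rewrite U0 /codim dimv0 subn0; lia.
  pose F := vpick U; pose U' := (U :\: <[F]>)%VS.
  have F0 : F != 0 by rewrite vpick0.
  have FU : (<[F]> <= U)%VS by rewrite -memvE memv_pick.
  have UE : (U' + <[F]>)%VS = U by rewrite addv_diff; apply/addv_idPl.
  have FU' : F \notin U'.
    apply: contra F0; rewrite -memv0 -(capv_diff U <[F]>) memv_cap => -> /=.
    exact: memv_line.
  exists U', F; rewrite idl1; split=> //.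
    by have := codim_addv FU'; rewrite UE cU.
  by rewrite eV -ups_idl /hypersurface !idl1 UE.
elim: j V => [|[|j] IHj] V; [exact: hypersurface_deg0 | exact: hypersurface_deg1 |].
apply: hypersurface_step; elim: j {IHj V} => [|j]; first exact: hypersurface_deg1.
exact: hypersurface_step.
Qed.

End GradedAlgebra.

(** * Polynomial rings *)

Section Forms.
Variables (K : fieldType) (n : nat).
Local Notation R := {mpoly K[n.+1]}.
Local Notation form := (dhomog n.+1 K).

Lemma form_mul_proof d (L : form 1) (g : form d) : val L * val g \is d.+1.-homog.
Proof. exact: (dhomogM (dhomog_is_dhomog L) (dhomog_is_dhomog g)). Qed.

Definition form_mul_fun d (L : form 1) (g : form d) : form d.+1 :=
  DHomog (form_mul_proof L g).

Lemma form_mul_is_linear d L : linear (@form_mul_fun d L).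
Proof.
by move=> a f g; apply: val_inj; rewrite /= mulrDr -scalerAr.
Qed.

HB.instance Definition _ d L :=
  GRing.isLinear.Build K (form d) (form d.+1) _ (@form_mul_fun d L)
    (@form_mul_is_linear d L).

Definition form_mul d (L : form 1) : 'Hom(form d, form d.+1) :=
  linfun (@form_mul_fun d L).

Lemma val_form_mul d L g : val (form_mul d L g) = val L * val g.
Proof. by rewrite lfunE. Qed.

Lemma form_mul_line d t x y : form_mul d (x + t *: y) = form_mul d x + t *: form_mul d y.
Proof.
apply/lfunP => g; rewrite add_lfunE scale_lfunE; apply: val_inj.
by rewrite /= !val_form_mul /= mulrDl -scalerAl.
Qed.

Lemma form_mulC d L L' g :
  form_mul d.+1 L (form_mul d L' g) = form_mul d.+1 L' (form_mul d L g).
Proof. by apply: val_inj; rewrite !val_form_mul mulrCA. Qed.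

Definition form_one : form 0 := DHomog (dhomog1 K mdeg).

Lemma form_mul_one L : form_mul 0 L form_one = L.
Proof. by apply: val_inj; rewrite val_form_mul mulr1. Qed.

Lemma form0_line (g : form 0) : exists a, g = a *: form_one.
Proof.
exists (val g)@_0; apply: val_inj; apply/mpolyP => m /=.
rewrite mcoeffZ mcoeff1; have [->|m0] := eqVneq m 0%MM; first by rewrite mulr1.
rewrite mulr0; apply: (@dhomog_nemf_coeff _ _ _ 0 _ _ (dhomog_is_dhomog g)).
by rewrite mdeg_eq0.
Qed.

Lemma form_monomialP d (V : {vspace form d}) :
  (forall (m : 'X_{1..n.+1}) (h : 'X_[m] \is d.-homog), DHomog h \in V) -> V = fullv.
Proof.
move=> hV; apply/eqP; rewrite eqEsubv subvf; apply/subvP => p _.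
have hm (m : 'X_{1..n.+1}) : m \in msupp (val p) -> 'X_[K, m] \is d.-homog.
  by move=> /(dhomog_mf (dhomog_is_dhomog p)) mE; rewrite dhomogX mE.
have -> : p = \sum_(m <- msupp (val p)) (val p)@_m *: insubd 0 ('X_[m]).
  apply: val_inj; rewrite [LHS]mpolyE linear_sum /= big_seq [RHS]big_seq.
  by apply: eq_bigr => m mp; rewrite /= insubdK //; apply: hm.
rewrite big_seq; apply: memv_suml => m /hm mh; apply: memvZ.
by rewrite (_ : insubd _ _ = DHomog mh) //; apply: val_inj; rewrite /= insubdK.
Qed.

Lemma form_gen d (V : {vspace form d.+1}) :
  (forall L g, form_mul d L g \in V) -> V = fullv.
Proof.
move=> hV; apply: form_monomialP => m mh.
have md : mdeg m = d.+1 by apply/eqP; rewrite -(dhomogX K).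
have [i mi] : exists i, (0 < m i)%N.
  apply/existsP; apply: contraT; rewrite negb_exists => /forallP m0.
  move: md; rewrite mdegE big1 // => i _; apply/eqP; by rewrite -leqn0 leqNgt m0.
have mE : m = (U_(i) + (m - U_(i)))%MM.
  by rewrite addmC submK //; rewrite lep1mP -lt0n.
have h1 : 'X_[K, U_(i)] \is 1.-homog by rewrite dhomogX /= mdeg1.
have h2 : 'X_[K, m - U_(i)] \is d.-homog.
  by rewrite dhomogX; have := congr1 mdeg mE; rewrite mdegD mdeg1 md => -[->].
have := hV (DHomog h1) (DHomog h2); congr (_ \in V); apply: val_inj.
by rewrite val_form_mul /= -mpolyXD -mE.
Qed.

Lemma dim_form d : \dim {:form d} = nmon d (\dim {:form 1}).
Proof.
rewrite !dimvf /= /dim /= /nmon !(addnC 1%N) !bin1.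
by rewrite addn1 addnS.
Qed.

Lemma dim_form1 : \dim {:form 1} = n.+1.
Proof. by rewrite dimvf /dim /= bin1 add1n. Qed.

Section InfiniteField.
Hypothesis Kinf : forall s : seq K, exists x : K, x \notin s.

Lemma digits_inj r B (f g : nat -> nat) : (forall i, f i < B)%N -> (forall i, g i < B)%N ->
    (\sum_(i < r) f i * B ^ i = \sum_(i < r) g i * B ^ i)%N ->
  forall i, (i < r)%N -> f i = g i.
Proof.
move=> + + + i; elim: r f g i => // r IHr f g i fB gB.
have B0 : (0 < B)%N by apply: leq_ltn_trans (fB 0%N).
rewrite !big_ord_recl /= !expn0 !muln1.
have E (u : nat -> nat) : (\sum_(j < r) u (bump 0 j) * B ^ bump 0 j =
    (\sum_(j < r) u j.+1 * B ^ j) * B)%N.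
  by rewrite big_distrl; apply: eq_bigr => j _; rewrite /bump /= add1n expnSr mulnA.
rewrite !E => e; have e0 : f 0%N = g 0%N.
  by have := congr1 (modn^~ B) e; rewrite !(addnC (_ 0%N)) !modnMDl !modn_small.
case: i => [|i] //; rewrite ltnS; apply: (IHr (f \o S) (g \o S)) => [j|j|] /=.
- exact: fB.
- exact: gB.
by move: e; rewrite e0 => /addnI/eqP; rewrite eqn_pmul2r // => /eqP.
Qed.

Lemma horner_mmap (h : 'I_n.+1 -> {poly K}) (p : R) t :
  (mmap polyC h p).[t] = p.@[fun i => (h i).[t]].
Proof.
rewrite mevalE /mmap horner_sum; apply: eq_bigr => m _.
rewrite hornerM hornerC /mmap1 horner_prod; congr (_ * _).
by apply: eq_bigr => i _; rewrite horner_exp.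
Qed.

(* Kronecker substitution. *)
Lemma meval_eq0 (p : R) : (forall v : 'rV[K]_n.+1, p.@[fun i => v 0 i] = 0) -> p = 0.
Proof.
move=> p0; pose B := (msize p).+1.
pose e (m : 'X_{1..n.+1}) := (\sum_(i < n.+1) m i * B ^ i)%N.
pose q := mmap polyC (fun i => 'X^(B ^ i)) p.
have q0 : q = 0.
  apply/eqP/negPn/negP => /(nonroot Kinf)[t] /eqP[]; rewrite horner_mmap.
  rewrite -(p0 (\row_i t ^+ (B ^ i))); apply: meval_eq => i.
  by rewrite hornerXn mxE.
have qE : q = \sum_(m <- msupp p) p@_m *: 'X^(e m).
  rewrite /q /mmap; apply: eq_bigr => m _; rewrite mul_polyC; congr (_ *: _).
  rewrite /mmap1 /e; elim/big_rec2: _ => [|i y x _ ->]; first by rewrite expr0.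
  by rewrite exprD -exprM mulnC.
have ltB m i : m \in msupp p -> (m i < B)%N.
  move/msize_mdeg_lt => lt; rewrite /B ltnS (leq_trans _ (ltnW lt)) //.
  by rewrite mdegE (bigD1 i) //= leq_addr.
apply/mpolyP => m; rewrite mcoeff0; apply/eqP; apply: contraT => mp.
rewrite -mcoeff_msupp in mp.
have := congr1 (fun q : {poly K} => q`_(e m)) q0.
rewrite coef0 qE coef_sum (bigD1_seq m) ?msupp_uniq //= coefZ coefXn eqxx mulr1.
rewrite big_seq_cond big1 ?addr0 => [|m' /andP[m'p m'm]]; last first.
  rewrite coefZ coefXn; case: eqP => [eE|]; last by rewrite mulr0.
  case/negP: m'm; apply/eqP/mnmP => i.
  (* Exponent vectors are extended by 0 to all naturals, as [digits_inj] expects; each exponent is a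
     digit in base B because it is below [msize p]. *)
  have := @digits_inj n.+1 B (fun j => if insub j is Some i then m' i else 0%N)
    (fun j => if insub j is Some i then m i else 0%N) _ _ _ i (ltn_ord i).
  rewrite valK; apply=> [j|j|]; try by case: insubP => // i' _ _; apply: ltB.
  by under eq_bigr do rewrite valK; under [in RHS]eq_bigr do rewrite valK.
by move/eqP; rewrite mcoeff_eq0 mp.
Qed.
End InfiniteField.

(** By excluded middle a subspace contained in P either exhausts P or can be enlarged by a vector of
    P; the codimension bounds the number of enlargements. *)
Lemma vspace_of_pred (vT : vectType K) (P : vT -> Prop) : P 0 ->
    (forall a u v, P u -> P v -> P (a *: u + v)) ->
  exists V : {vspace vT}, forall v, P v <-> v \in V.
Proof.
move=> P0 PD.
have [i le] := ubnP (codim (0 : {vspace vT})).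
have : forall v : vT, v \in 0%VS -> P v by move=> v; rewrite memv0 => /eqP ->.
elim: i (0%VS : {vspace vT}) le => // i IHi U; rewrite ltnS => le UP.
case: (classic (exists2 v, P v & v \notin U)) => [[v Pv vU]|nex]; last first.
  exists U => v; split=> [Pv|/UP//]; apply/negPn/negP => vU.
  by apply: nex; exists v.
apply: (IHi (U + <[v]>)%VS) => [|_ /memv_addP[u uU [_ /vlineP[a ->] ->]]].
  by apply: leq_trans (codim_lt vU) le.
by rewrite addrC; apply: PD => //; apply: UP.
Qed.

Lemma quotient_dim_codim (I : R -> Prop) d m (V : {vspace form d}) :
  (forall p : form d, I (val p) <-> p \in V) -> quotient_dim I d m -> codim V = m.
Proof.
move=> VE [b bP]; pose X := [tuple b i | i < m].
have Xnth (a : 'I_m -> K) : \sum_i a i *: b i = \sum_(i < m) a i *: X`_i.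
  by apply: eq_bigr => i _; rewrite -tnth_nth tnth_mktuple.
have uniqX (a : 'I_m -> K) : \sum_i a i *: b i \in V -> forall i, a i = 0.
  move=> aV; have [a0 [_ a0u]] := bP 0.
  have e1 : a0 = [ffun=> 0].
    apply: a0u; apply/VE; rewrite big1 ?subrr ?mem0v // => i _.
    by rewrite ffunE scale0r.
  have e2 : a0 = finfun a.
    apply: a0u; apply/VE; rewrite sub0r memvN.
    by under eq_bigr do rewrite ffunE.
  by move=> i; have := congr1 (fun f : {ffun _} => f i) e2; rewrite e1 !ffunE.
have freeX : free X.
  by apply/freeP => a; rewrite -Xnth => a0 i; apply: uniqX; rewrite a0 mem0v.
have dimX : \dim <<X>> = m by rewrite (eqP freeX) size_tuple.
have capX : (V :&: <<X>> = 0)%VS.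
  apply/eqP; rewrite -subv0; apply/subvP => v; rewrite memv_cap => /andP[vV vX].
  move: vV; rewrite (coord_span vX) -Xnth => /uniqX a0.
  by rewrite big1 ?mem0v // => i _; rewrite a0 scale0r.
have addX : (V + <<X>> = fullv)%VS.
  apply/eqP; rewrite eqEsubv subvf; apply/subvP => p _.
  have [a [/VE aV _]] := bP p; rewrite -(subrK (\sum_i a i *: b i) p) memv_add //.
  rewrite Xnth; apply: memv_suml => i _.
  by rewrite memvZ // memv_span ?mem_nth ?size_tuple.
have := dimv_sum_cap V <<X>>; rewrite addX capX dimv0 addn0 dimX => e.
by rewrite /codim e addKn.
Qed.

Lemma zariski_line_open (U : form 1 -> Prop) : zariski_open U -> line_open U.
Proof.
move=> [G UE] x y /UE[g Gg gx].
pose h i := ((val x)@_(U_(i)))%:P + (val y)@_(U_(i)) *: 'X : {poly K}.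
have hE t : (mmap polyC h g).[t] = g.@[fun i => (val (x + t *: y))@_(U_(i))].
  rewrite horner_mmap; apply: meval_eq => i.
  by rewrite !hornerE /= mcoeffD mcoeffZ mulrC.
exists (mmap polyC h g) => [|t]; rewrite hE; first by rewrite scale0r addr0.
by move=> gt; apply/UE; exists g.
Qed.

(** * Ideals and their homogeneous components *)

Section IdealGen.
Implicit Types (G J : R -> Prop).

Lemma ideal_gen_mem G q f : G f -> ideal_gen G (q * f).
Proof. by move=> Gf; exists 1%N, (fun=> q), (fun=> f); split; rewrite ?big_ord1. Qed.

Lemma ideal_gen_sub G f : G f -> ideal_gen G f.
Proof. by move=> Gf; rewrite -(mul1r f); apply: ideal_gen_mem. Qed.

Lemma ideal_gen_is_ideal G : is_ideal (ideal_gen G).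
Proof.
split=> [|p q [r [a [f [fG ->]]]] [s [b [g [gG ->]]]]|p q [r [a [f [fG ->]]]]].
- by exists 0%N, (fun=> 0), (fun=> 0); split; rewrite ?big_ord0 // => -[].
- exists (r + s)%N, (fun i => match split i with inl j => a j | inr j => b j end),
    (fun i => match split i with inl j => f j | inr j => g j end); split.
    by move=> i; case: split.
  rewrite big_split_ord; congr (_ + _); apply: eq_bigr => i _.
    by rewrite (unsplitK (inl i)).
  by rewrite (unsplitK (inr i)).
exists r, (fun i => p * a i), f; split=> //; rewrite big_distrr.
by apply: eq_bigr => i _ /=; rewrite mulrA.
Qed.

Lemma is_ideal_sum J (hJ : is_ideal J) (T : Type) (r : seq T) (F : T -> R) :
  (forall i, J (F i)) -> J (\sum_(i <- r) F i).
Proof. by case: hJ => J0 JD _ JF; elim/big_ind: _ => // i _; apply: JF. Qed.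

Lemma ideal_gen_min G J : is_ideal J -> (forall f, G f -> J f) ->
  forall p, ideal_gen G p -> J p.
Proof.
move=> hJ GJ _ [m [q [f [fG ->]]]]; apply: is_ideal_sum => // i.
by case: hJ => _ _; apply; apply: GJ.
Qed.

Lemma is_idealZ J a p : is_ideal J -> J p -> J (a *: p).
Proof. by case=> _ _ JM Jp; rewrite -mul_mpolyC; apply: JM. Qed.

Lemma ideal_component J d : is_ideal J ->
  exists V : {vspace form d}, forall p : form d, J (val p) <-> p \in V.
Proof.
move=> hJ; have [J0 JD _] := hJ; apply: vspace_of_pred => // a u v Ju Jv.
by rewrite linearP; apply: JD => //; apply: is_idealZ.
Qed.
End IdealGen.

Lemma pihomogM d e (q : R) (f : form e) :
  pihomog mdeg (d + e) (q * val f) = pihomog mdeg d q * val f.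
Proof.
have [k le] : exists k, (msize q <= k)%N by exists (msize q).
rewrite [q in LHS](pihomog_partitionE le) mulr_suml linear_sum /=.
have E (i : 'I_k) : pihomog mdeg (d + e) (pihomog mdeg i q * val f) =
    if i == d :> nat then pihomog mdeg d q * val f else 0.
  have hi : pihomog mdeg i q * val f \is (i + e).-homog.
    by apply: dhomogM (dhomog_is_dhomog f); apply: pihomogP.
  case: eqP => [<-|id]; first by rewrite pihomog_dE.
  by apply: pihomog_ne0 hi; apply/eqP; lia.
rewrite (eq_bigr _ (fun i _ => E i)); case: (ltnP d k) => [dk|kd].
  rewrite (bigD1 (Ordinal dk)) //= eqxx big1 ?addr0 // => i id.
  by case: eqP => // e'; case/eqP: id; apply: val_inj.
rewrite big1 => [|i _]; last by case: eqP => // e'; have := ltn_ord i; lia.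
rewrite pihomogE big_seq_cond big1 ?mul0r // => m /andP[mq /eqP md].
have := msize_mdeg_lt mq; move: md => /= ->; lia.
Qed.

Lemma pihomogM_lt d e (q : R) (f : form e) : (d < e)%N ->
  pihomog mdeg d (q * val f) = 0.
Proof.
move=> de.
have [k le] : exists k, (msize q <= k)%N by exists (msize q).
rewrite (pihomog_partitionE le) mulr_suml linear_sum /= big1 // => i _.
have hi : pihomog mdeg i q * val f \is (i + e).-homog.
  by apply: dhomogM (dhomog_is_dhomog f); apply: pihomogP.
by apply: pihomog_ne0 hi; apply/eqP; lia.
Qed.

Definition hcomp d (p : R) : form d := DHomog (pihomogP mdeg d p).

Lemma hcompK d (p : form d) : hcomp d (val p) = p.
Proof. apply: val_inj; exact: pihomog_dE (dhomog_is_dhomog p). Qed.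

Lemma hcomp_linear d : linear (hcomp d).
Proof. by move=> a p q; apply: val_inj; rewrite /= linearP. Qed.

HB.instance Definition _ d :=
  GRing.isLinear.Build K R (form d) _ (hcomp d) (@hcomp_linear d).

Lemma hcomp_mul_form1 d q (L : form 1) : hcomp d.+1 (q * val L) = form_mul d L (hcomp d q).
Proof.
apply: val_inj; rewrite val_form_mul [RHS]mulrC.
by have := pihomogM d q L; rewrite addn1.
Qed.

Lemma hcomp0_mul_form1 q (L : form 1) : hcomp 0 (q * val L) = 0.
Proof. by apply: val_inj; rewrite /= pihomogM_lt. Qed.

Lemma hyperplane_component (I : R -> Prop) d (V : {vspace form d}) (L : form 1)
    (p : form d) :
    homogeneous_ideal I -> (forall p : form d, I (val p) <-> p \in V) ->
  ideal_add I (fun p => p = val L) (val p) <-> p \in (V + hyp form_mul L d)%VS.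
Proof.
move=> [hI Ihom] VE; have hA := ideal_gen_is_ideal (fun p => I p \/ p = val L).
split=> [Ap|/memv_addP[v vV [w wL ->]]].
  rewrite -(hcompK p).
  (* Elements of (I, L) are of the form v + q L, and homogeneity of I keeps the degree d part of v
     in V. *)
  pose J f := exists v q, I v /\ f = v + q * val L.
  have : J (val p).
    apply: (@ideal_gen_min _ J _ _ _ Ap) => [|f [If|->]].
    - have [I0 ID IM] := hI; split.
      + by exists 0, 0; rewrite mul0r addr0.
      + move=> _ _ [v [q [Iv ->]]] [w [r [Iw ->]]]; exists (v + w), (q + r).
        by rewrite mulrDl addrACA; split=> //; apply: ID.
      move=> a _ [v [q [Iv ->]]]; exists (a * v), (a * q).
      by rewrite mulrDr mulrA; split=> //; apply: IM.
    - by exists f, 0; rewrite mul0r addr0.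
    by exists 0, 1; rewrite mul1r add0r; case: hI.
  move=> [v [q [Iv ->]]].
  rewrite [hcomp d _](linearD (hcomp d) v (q * val L) : _ = hcomp d v + hcomp d _).
  rewrite memv_add //.
    by apply/VE; apply: Ihom.
  case: (d) => [|e]; first by rewrite hcomp0_mul_form1 mem0v.
  by rewrite hcomp_mul_form1 memv_img ?memvf.
case: hA => A0 AD AM; apply: (AD (val v) (val w)).
  by apply: ideal_gen_sub; left; apply/VE.
case: d V VE p v vV w wL => [|d] V VE p v vV w; first by rewrite memv0 => /eqP ->.
case/memv_imgP => g _ ->; rewrite val_form_mul mulrC; apply: ideal_gen_mem.
by right.
Qed.
Lemma form1_expand (u : form 1) : val u = \sum_i (val u)@_(U_(i)) *: 'X_i.
Proof.
apply/mpolyP => m; rewrite linear_sum /=.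
case: (mdeg1P m) => [[j /eqP ->]|nm].
  rewrite (bigD1 j) //= mcoeffZ mcoeffXU eqxx mulr1 big1 ?addr0 // => i ij.
  by rewrite mcoeffZ mcoeffXU (negbTE ij) mulr0.
rewrite (dhomog_nemf_coeff (dhomog_is_dhomog u)); last first.
  by apply/eqP => /eqP/mdeg1P.
rewrite big1 // => i _; rewrite mcoeffZ mcoeffX.
case: eqP => [e|]; last by rewrite mulr0.
by case: nm; exists i; rewrite e.
Qed.

(** * Linear subspaces and their ideals *)

Section LinearSpace.
Variables (r : nat) (L : r.-tuple (form 1)).
Hypothesis freeL : free L.

Definition coef_mx : 'M[K]_(n.+1, r) := \matrix_(i, j) (val (tnth L j))@_(U_(i)).

Definition linear_space : {vspace 'rV[K]_n.+1} := lker (linfun (mulmxr coef_mx)).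

Lemma mem_linear_space (v : 'rV[K]_n.+1) : (v \in linear_space) = (v *m coef_mx == 0).
Proof. by rewrite memv_ker lfunE. Qed.

Lemma meval_coef_mx (v : 'rV[K]_n.+1) j :
  (val (tnth L j)).@[fun i => v 0 i] = (v *m coef_mx) 0 j.
Proof.
rewrite mxE form1_expand linear_sum /=; apply: eq_bigr => i _.
by rewrite mevalZ mevalXU mxE mulrC.
Qed.

Lemma coef_mx_linv : exists B : 'M[K]_(r, n.+1), B *m coef_mx = 1%:M.
Proof.
have /row_freeP[C AC] : row_free coef_mx^T.
  apply: inj_row_free => u uA.
  have h : \sum_(j < r) u 0 j *: L`_j = 0.
    set w := \sum_(j < r) _; apply: val_inj; rewrite form1_expand big1 //= => i _.
    rewrite /w linear_sum /= linear_sum /=.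
    have := congr1 (fun M : 'rV_ _ => M 0 i) uA; rewrite !mxE => e.
    rewrite (_ : \sum_(_ < r) _ = 0) ?scale0r // -[RHS]e; apply: eq_bigr => j _.
    by rewrite !mxE (tnth_nth 0) mcoeffZ.
  apply/rowP => j; rewrite mxE.
  by have /freeP := freeL; apply.
exists C^T; by rewrite -[coef_mx]trmxK -trmx_mul AC trmx1.
Qed.

Lemma dim_linear_space : \dim linear_space = (n.+1 - r)%N.
Proof.
have [B BA] := coef_mx_linv.
pose f : 'Hom('rV[K]_n.+1, 'rV[K]_r) := linfun (mulmxr coef_mx).
have := limg_ker_dim f fullv; rewrite capfv.
have -> : limg f = fullv.
  apply/eqP; rewrite eqEsubv subvf; apply/subvP => w _; apply/memv_imgP.
  by exists (w *m B); rewrite ?memvf // lfunE /= -mulmxA BA mulmx1.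
rewrite !dimvf !dim_matrix -![(1%N * _)%R]/(1 * _)%N !mul1n => e.
by have := congr1 (subn^~ r) e; rewrite addnK.
Qed.

Local Notation gens := (fun f => exists i, f = val (tnth L i)).

Lemma comp_mpoly_congr (J : R -> Prop) (y : n.+1.-tuple R) : is_ideal J ->
  (forall i, J ('X_i - tnth y i)) -> forall p, J (p - (p \mPo y)).
Proof.
move=> hJ Jy; have [J0 JD JM] := hJ.
have JMM p q : J (p - (p \mPo y)) -> J (q - (q \mPo y)) -> J (p * q - ((p * q) \mPo y)).
  move=> Jp Jq; rewrite rmorphM.
  have -> : p * q - (p \mPo y) * (q \mPo y) =
      p * (q - (q \mPo y)) + (q \mPo y) * (p - (p \mPo y)).
    by rewrite !mulrBr [(q \mPo y) * p]mulrC addrA subrK [X in _ = _ - X]mulrC.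
  by apply: JD; apply: JM.
have JX m : J ('X_[m] - ('X_[m] \mPo y)).
  rewrite mpolyXE_id; elim/big_rec: _ => [|i q _ Jq]; first by rewrite rmorph1 subrr.
  apply: (JMM) => //; elim: (m i) => [|e IHe]; first by rewrite expr0 rmorph1 subrr.
  by rewrite exprS; apply: (JMM) => //; rewrite comp_mpolyXU -tnth_nth.
move=> p; elim/mpolyind: p => [|a m p _ _ Jp]; first by rewrite rmorph0 subrr.
rewrite linearP opprD addrACA -scalerBr; apply: JD => //.
exact: is_idealZ.
Qed.

(* A polynomial vanishing on the linear space is congruent, modulo the linear
   forms, to its composition with a projection onto that space. *)
Lemma linear_space_idealP (Kinf : forall s : seq K, exists x : K, x \notin s) p :
  linear_space_ideal linear_space p <-> ideal_gen gens p.
Proof.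
have hG := ideal_gen_is_ideal gens; split=> [pW|[m [q [f [fL ->]]]] v vW]; last first.
  rewrite linear_sum /= big1 // => i _; rewrite mevalM.
  have [j ->] := fL i; rewrite meval_coef_mx.
  by move: vW; rewrite mem_linear_space => /eqP ->; rewrite mxE mulr0.
(* As B is a left inverse of [coef_mx], the matrix P sends every row vector into the linear space;
   X_i - y_i is then the i-th coordinate of the complementary part, a combination of the L_j. *)
have [B BA] := coef_mx_linv; pose P := 1%:M - coef_mx *m B.
pose y := [tuple \sum_k P k i *: ('X_k : R) | i < n.+1].
have y0 : p \mPo y = 0.
  apply: (meval_eq0 Kinf) => v; rewrite comp_mpoly_meval.
  have PW : v *m P \in linear_space.
    rewrite mem_linear_space -mulmxA mulmxBl mul1mx -mulmxA BA mulmx1 subrr.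
    by rewrite mulmx0.
  rewrite -(pW _ PW); apply: meval_eq => i.
  rewrite tnth_mktuple linear_sum mxE /=; apply: eq_bigr => k _.
  by rewrite mevalZ mevalXU mulrC.
rewrite -[p]subr0 -y0; apply: comp_mpoly_congr => // i.
have -> : 'X_i - tnth y i = \sum_j B j i *: val (tnth L j).
  rewrite tnth_mktuple.
  under [in RHS]eq_bigr => j _ do rewrite form1_expand scaler_sumr.
  rewrite exchange_big /=.
  have -> : 'X_i = \sum_k (1%:M : 'M[K]_n.+1) k i *: 'X_k :> R.
    rewrite (bigD1 i) //= mxE eqxx scale1r big1 ?addr0 // => k ki.
    by rewrite mxE (negbTE ki) scale0r.
  rewrite -sumrB; apply: eq_bigr => k _; rewrite -scalerBl.
  rewrite (eq_bigr (fun j => (coef_mx k j * B j i) *: 'X_k)) => [|j _]; last first.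
    by rewrite scalerA mulrC mxE.
  by rewrite -scaler_suml; congr (_ *: _); rewrite !mxE opprB addrC subrK.
apply: is_ideal_sum => // j; apply: is_idealZ => //.
by apply: ideal_gen_sub; exists j.
Qed.

End LinearSpace.
Local Notation idl := (idl (@form_mul)).
Local Notation up := (up (@form_mul)).
Local Notation ups := (ups (@form_mul)).
Local Notation hypersurface := (hypersurface (@form_mul)).

Lemma up_ideal (J : R -> Prop) d (V : {vspace form d}) : is_ideal J ->
  (forall p, p \in V -> J (val p)) -> forall p, p \in up V -> J (val p).
Proof.
move=> hJ JV p; have [W WE] := ideal_component d.+1 hJ.
move=> pV; apply/WE; apply: subvP pV; apply/(up_subP form_mul_line) => L g gV.
by apply/WE; rewrite val_form_mul; case: hJ => _ _; apply; apply: JV.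
Qed.

Lemma ups_ideal (J : R -> Prop) j d (V : {vspace form d}) : is_ideal J ->
  (forall p, p \in V -> J (val p)) -> forall p, p \in ups j V -> J (val p).
Proof. by move=> hJ JV; elim: j => [|j IHj] //=; apply: up_ideal. Qed.

Lemma idl_ideal (J : R -> Prop) d (U : {vspace form 1}) : is_ideal J ->
  (forall p, p \in U -> J (val p)) -> forall p, p \in idl U d -> J (val p).
Proof.
move=> hJ JU; case: d => [|d] p.
  by rewrite memv0 => /eqP ->; case: hJ.
have [W WE] := ideal_component d.+1 hJ.
move=> pU; apply/WE; apply: subvP pU; apply/(idl_subP form_mul_line) => u g uU.
by apply/WE; rewrite val_form_mul mulrC; case: hJ => _ _; apply; apply: JU.
Qed.

Lemma hcomp_idl d (U : {vspace form 1}) L q : L \in U ->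
  hcomp d (q * val L) \in idl U d.
Proof.
move=> LU; case: d => [|d]; first by rewrite hcomp0_mul_form1 mem0v.
by rewrite hcomp_mul_form1; apply: (mem_idl form_mul_line).
Qed.

Lemma idl_forms d (U : {vspace form 1}) (r : nat) (L : r.-tuple (form 1)) (p : form d) :
    <<L>>%VS = U ->
  ideal_gen (fun f => exists i, f = val (tnth L i)) (val p) <-> p \in idl U d.
Proof.
move=> LU; set G := fun f : R => _; split=> [[m [q [f [fG pE]]]]|].
  rewrite -(hcompK p) pE linear_sum; apply: memv_suml => i _ /=.
  by have [l ->] := fG i; apply: hcomp_idl; rewrite -LU memv_span ?mem_tnth.
apply: idl_ideal => [|u]; first exact: ideal_gen_is_ideal.
have [W WE] := ideal_component 1 (ideal_gen_is_ideal G).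
rewrite -LU => uL; apply/WE; apply: subvP uL; apply/span_subvP => _ /tnthP[i ->].
by apply/WE; apply: ideal_gen_sub; exists i.
Qed.

Lemma form_mulr_proof j e (f : form e) (q : form j) : val q * val f \is (j + e).-homog.
Proof. exact: (dhomogM (dhomog_is_dhomog q) (dhomog_is_dhomog f)). Qed.

Definition form_mulr_fun j e (f : form e) (q : form j) : form (j + e) :=
  DHomog (form_mulr_proof f q).

Lemma form_mulr_is_linear j e f : linear (@form_mulr_fun j e f).
Proof. by move=> a p q; apply: val_inj; rewrite /= mulrDl -scalerAl. Qed.

HB.instance Definition _ j e f :=
  GRing.isLinear.Build K (form j) (form (j + e)) _ (@form_mulr_fun j e f)
    (@form_mulr_is_linear j e f).

(** Iterating [up] multiplies by linear forms only. The forms q with q f in [ups j <[f]>] make up a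
    subspace, and it contains every L g because of the previous degree, so [form_gen] applies. *)
Lemma mem_ups_line j e (f : form e) (q : form j) : form_mulr_fun f q \in ups j <[f]>.
Proof.
suff h : (linfun (@form_mulr_fun j e f) @^-1: ups j <[f]>)%VS = fullv.
  by rewrite -[form_mulr_fun f q](lfunE (@form_mulr_fun j e f)) memv_preim h memvf.
elim: j {q} => [|j IHj].
  apply/eqP; rewrite eqEsubv subvf; apply/subvP => q _.
  rewrite -memv_preim lfunE /=; have [a ->] := form0_line q.
  by apply/vlineP; exists a; apply: val_inj; rewrite /= -scalerAl mul1r.
apply: form_gen => L g; rewrite -memv_preim lfunE.
rewrite -[X in X \in _]/(form_mulr_fun f (form_mul j L g)).
have -> : form_mulr_fun f (form_mul j L g) = form_mul (j + e) L (form_mulr_fun f g).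
  by apply: val_inj; rewrite val_form_mul /= val_form_mul mulrA.
apply: (mem_up form_mul_line).
by rewrite -(lfunE (@form_mulr_fun j e f)) memv_preim IHj memvf.
Qed.

Lemma hypersurface_forms j k (U : {vspace form 1}) (F : form k.+1) (r : nat)
    (L : r.-tuple (form 1)) (p : form (j + k.+1)) : <<L>>%VS = U ->
  ideal_gen (fun f => (exists i, f = val (tnth L i)) \/ f = val F) (val p) <->
  p \in ups j (hypersurface U F).
Proof.
move=> LU; set G := fun f : R => _; split=> [[m [q [f [fG pE]]]]|]; last first.
  have hG := ideal_gen_is_ideal G; have [_ GD _] := hG.
  apply: ups_ideal => // _ /memv_addP[u uU [_ /vlineP[a ->] ->]].
  apply: (GD (val u) (val (a *: F))).
    apply: (ideal_gen_min hG) ((idl_forms u LU).2 uU) => f fL.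
    by apply: ideal_gen_sub; left.
  by apply: (is_idealZ _ hG); apply: ideal_gen_sub; right.
rewrite -(hcompK p) pE linear_sum; apply: memv_suml => i _.
rewrite (ups_add form_mul_line).
case: (fG i) => [[l ->]|->] /=.
  apply: subvP (addvSl _ _) _ _; rewrite (ups_idl form_mul_line (@form_mulC) (@form_gen)).
  by apply: hcomp_idl; rewrite -LU memv_span ?mem_tnth.
apply: subvP (addvSr _ _) _ _.
have -> : hcomp (j + k.+1) (q i * val F) = form_mulr_fun F (hcomp j (q i)).
  by apply: val_inj; rewrite /= pihomogM.
exact: mem_ups_line.
Qed.

End Forms.

Theorem theorem3p2 (K : fieldType)
    (Kinf : forall s : seq K, exists x : K, x \notin s)
    (Kchar0 : [pchar K] =i pred0)
    (n : nat) (I : {mpoly K[n.+1]} -> Prop) (hI : homogeneous_ideal I)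
    (d c k h l : nat)
    (c_gt0 : (0 < c)%N) (c_ltn : (c < n)%N)
    (hh : quotient_dim I d h)
    (hl : for_general_linear_form (fun L =>
            quotient_dim (ideal_add I (fun p => p = val L)) d l))
    (hexp : binomial_expansion h d [seq (d + c - t)%N | t <- iota 0 k.+1])
    (hgreen : shifted_expansion h d 0 (-1) l) :
  exists (W : {vspace 'rV[K]_n.+1}) (F : dhomog n.+1 K k.+1)
         (L : (n - c.+1).-tuple (dhomog n.+1 K 1)),
    [/\ \dim W = c.+2,
        ~ linear_space_ideal W (val F),
        free L
      & forall p, linear_space_ideal W p <->
          ideal_gen (fun f => exists i, f = val (tnth L i)) p] /\
    eq_in_degree d I
      (ideal_add (linear_space_ideal W) (hypersurface_ideal W (val F))) /\
    eq_in_degree d I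
      (ideal_gen (fun f => (exists i, f = val (tnth L i)) \/ f = val F)).
Proof.
have [j dE] : exists j, d = (j + k.+1)%N.
  case: hexp; rewrite size_map size_iota => /andP[_ kd] _ _ _.
  by exists (d - k.+1)%N; rewrite subnK.
(* With c = m + 1, the codimension m + 3 = c + 2 of U is the dimension of the cone over the ambient
   linear space. *)
subst d; case: c c_gt0 c_ltn hexp => // m _ ltmn /hypersurface_expansion hE.
have lE := shifted_expansion_green hgreen; rewrite hE green_hmon in lE.
have [V VE] := ideal_component (j + k.+1) hI.1.
have cV : codim V = hmon j k m.+3 by rewrite (quotient_dim_codim VE hh).
have gV : general_codim (@form_mul K n) V (hmon j k m.+2).
  have [U [/zariski_line_open oU nU UP]] := hl.
  exists U; split=> // L /UP; rewrite lE; apply: quotient_dim_codim => p.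
  exact: hyperplane_component.
have lem : (m.+3 <= \dim {:dhomog n.+1 K 1})%N by rewrite dim_form1; lia.
have [U [F [cU FU eV]]] := extremal_hypersurface Kinf Kchar0 (@form_mul_line K n)
  (@form_mulC K n) (@form_mul_one K n) (@form0_line K n) (@form_gen K n)
  (@dim_form K n) lem cV gV.
have [L freeL LU] : exists2 L : (n - m.+2).-tuple (dhomog n.+1 K 1),
    free L & <<L>>%VS = U.
  have <- : \dim U = (n - m.+2)%N.
    by have := dim_codim U; rewrite cU dim_form1; lia.
  exists (vbasis U); first exact: basis_free (vbasisP U).
  exact: span_basis (vbasisP U).
have VL (p : dhomog n.+1 K (j + k.+1)) : I (val p) <->
    ideal_gen (fun f => (exists i, f = val (tnth L i)) \/ f = val F) (val p).
  by apply: (iff_trans (VE p)); rewrite eV; apply: iff_sym; apply: hypersurface_forms.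
pose W := linear_space L; have WE := linear_space_idealP freeL Kinf.
exists W, F, L; split; last split=> [p|//].
  split=> //; first by rewrite dim_linear_space //; lia.
  by move=> /WE/(idl_forms F LU) FU'; rewrite FU' in FU.
have hG := ideal_gen_is_ideal (fun f => (exists i, f = val (tnth L i)) \/ f = val F).
have [_ GD GM] := hG.
have GW q : linear_space_ideal W q ->
    ideal_gen (fun f => (exists i, f = val (tnth L i)) \/ f = val F) q.
  move/WE; apply: (ideal_gen_min hG) => f fL; apply: ideal_gen_sub; by left.
apply: (iff_trans (VL p)); split; apply: ideal_gen_min; try exact: ideal_gen_is_ideal.
  move=> f [[i ->]|->]; apply: ideal_gen_sub.
    by left; apply/WE; apply: ideal_gen_sub; exists i.
  by right; exists 1; rewrite mul1r subrr => v _; rewrite meval0.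
move=> f [/GW//|[q /GW fq]]; rewrite -(subrK (q * val F) f); apply: GD => //.
by apply: ideal_gen_mem; right.
Qed.
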